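(* For any $\lambda\ge0$, any nonnegative weights $w_1,w_2$, and any $\mu,\nu\in{\mathcal M}({\mathcal T})$, $$\mathrm{ET}_{c,\lambda}(\mu,\nu)=\sup_{(u,v)\in\mathbb{K}}\Big[\int_{\mathcal T} u(x)\,\mu(dx)+\int_{\mathcal T} v(x)\,\nu(dx)\Big],$$ where $\mathbb{K}$ is the set of pairs of functions $u\in L^1(\mu)$, $v\in L^1(\nu)$ on ${\mathcal T}$ such that $u\le w_1$, $-b\lambda+\inf_{x\in{\mathcal T}}[b\,c(x,y)-w_1(x)]\le v(y)\le w_2(y)$ for all $y\in{\mathcal T}$, and $u(x)+v(y)\le b[c(x,y)-\lambda]$ for all $x,y\in{\mathcal T}$.
   Context: Let ${\mathcal T}$ be a tree (identified with the set of its nodes and all points on its edges), ${\mathcal M}({\mathcal T})$ the set of nonnegative Borel measures on ${\mathcal T}$ with finite mass. Fix $b\ge0$, a continuous cost $c:{\mathcal T}\times{\mathcal T}\to\mathbb{R}$ with $c(x,x)=0$, and weights $w_1,w_2:{\mathcal T}\to[0,\infty)$. For $\mu,\nu\in{\mathcal M}({\mathcal T})$, $\Pi_{\le}(\mu,\nu)$ is the set of nonnegative finite Borel measures $\gamma$ on ${\mathcal T}\times{\mathcal T}$ with marginals $\gamma_1\le\mu$, $\gamma_2\le\nu$, and $\gamma_1=f_1\mu$, $\gamma_2=f_2\nu$. Define $\mathrm{ET}_{c,\lambda}(\mu,\nu):=\inf_{\gamma\in\Pi_\le(\mu,\nu)}\Big[\int_{\mathcal T} w_1[1-f_1]\,d\mu+\int_{\mathcal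 T} w_2[1-f_2]\,d\nu+b\int_{{\mathcal T}\times{\mathcal T}}[c(x,y)-\lambda]\,\gamma(dx,dy)\Big]$. *)

(* Defs.v *)
From HB Require Import structures.
From mathcomp Require Import all_boot all_order all_algebra.
From mathcomp Require Import all_classical all_reals all_analysis.
Set Implicit Arguments. Unset Strict Implicit. Unset Printing Implicit Defensive.
Import Order.TTheory GRing.Theory Num.Theory.
Local Open Scope classical_set_scope.
Local Open Scope ring_scope.

Definition is_metric (R : realType) (T : Type) (dist : T -> T -> R) : Prop :=
  [/\ forall x y, 0 <= dist x y,
      forall x y, dist x y = 0 <-> x = y,
      forall x y, dist x y = dist y x &
      forall x y z, dist x z <= dist x y + dist y z].

(** (T, dist) is a finite metric tree (the geometric realization of a finite
    tree with positive edge lengths: nodes together with all points on the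
    edges, with the path-length metric).  Characterized as a geodesic metric
    space satisfying the four-point condition (0-hyperbolic, i.e. an R-tree)
    which is the union of the geodesic segments between finitely many points
    (the nodes). *)
Definition finite_metric_tree (R : realType) (T : Type) (dist : T -> T -> R)
  : Prop :=
  [/\ is_metric dist,
      forall x y t, 0 <= t -> t <= dist x y ->
        exists z, dist x z = t /\ dist z y = dist x y - t,
      forall x y z w, dist x y + dist z w <=
        Num.max (dist x z + dist y w) (dist x w + dist y z) &
      exists (n : nat) (V : 'I_n -> T), forall x, exists i j,
        dist (V i) x + dist x (V j) = dist (V i) (V j)].

Definition dopen (R : realType) (T : Type) (dist : T -> T -> R) (A : set T)
  : Prop :=
  forall x, A x -> exists e : R, 0 < e /\ (forall y, dist x y < e -> A y).

Definition borel_wrt (R : realType) (d : measure_display) (T : measurableType d)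
  (dist : T -> T -> R) : Prop :=
  (@measurable d T) = <<s [set A | dopen dist A] >>.

Definition continuous2_wrt (R : realType) (T : Type) (dist : T -> T -> R)
  (c : T -> T -> R) : Prop :=
  forall x y (e : R), 0 < e -> exists delta : R, 0 < delta /\
    forall x' y', dist x x' < delta -> dist y y' < delta ->
      `|c x' y' - c x y| < e.

Definition Pi_le (R : realType) (d : measure_display) (T : measurableType d)
  (mu nu : {finite_measure set T -> \bar R})
  (gamma : {finite_measure set (T * T)%type -> \bar R}) (f1 f2 : T -> R) : Prop :=
  measurable_fun setT f1 /\ measurable_fun setT f2 /\
  (forall x, 0 <= f1 x) /\ (forall x, 0 <= f2 x) /\
  (forall A, measurable A -> (gamma (A `*` setT) <= mu A)%E) /\
  (forall A, measurable A -> (gamma (setT `*` A) <= nu A)%E) /\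
  (forall A, measurable A ->
     (gamma (A `*` setT) = \int[mu]_(x in A) (f1 x)%:E)%E) /\
  (forall A, measurable A ->
     (gamma (setT `*` A) = \int[nu]_(x in A) (f2 x)%:E)%E).

Definition ET_cost (R : realType) (d : measure_display) (T : measurableType d)
  (b lambda : R) (c : T -> T -> R) (w1 w2 : T -> R)
  (mu nu : {finite_measure set T -> \bar R})
  (gamma : {finite_measure set (T * T)%type -> \bar R}) (f1 f2 : T -> R) : \bar R :=
  (\int[mu]_x (w1 x * (1 - f1 x))%:E
   + \int[nu]_x (w2 x * (1 - f2 x))%:E
   + b%:E * \int[gamma]_z (c z.1 z.2 - lambda)%:E)%E.

Definition ET (R : realType) (d : measure_display) (T : measurableType d)
  (b lambda : R) (c : T -> T -> R) (w1 w2 : T -> R)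
  (mu nu : {finite_measure set T -> \bar R}) : \bar R :=
  ereal_inf [set z : \bar R | exists (gamma : {finite_measure set (T * T)%type -> \bar R})
    (f1 f2 : T -> R), Pi_le mu nu gamma f1 f2 /\
    z = ET_cost b lambda c w1 w2 mu nu gamma f1 f2].

Definition Kset (R : realType) (d : measure_display) (T : measurableType d)
  (b lambda : R) (c : T -> T -> R) (w1 w2 : T -> R)
  (mu nu : {finite_measure set T -> \bar R}) : set ((T -> R) * (T -> R))%type :=
  [set uv | let u := uv.1 in let v := uv.2 in
    [/\ mu.-integrable setT (EFin \o u),
        nu.-integrable setT (EFin \o v),
        (forall x, u x <= w1 x),
        (forall y, ((- (b * lambda))%:E
                     + ereal_inf [set (b * c x y - w1 x)%:E | x in setT]
                     <= (v y)%:E)%E /\ v y <= w2 y) &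
        (forall x y, u x + v y <= b * (c x y - lambda))]].

Definition ET_dual (R : realType) (d : measure_display) (T : measurableType d)
  (b lambda : R) (c : T -> T -> R) (w1 w2 : T -> R)
  (mu nu : {finite_measure set T -> \bar R}) : \bar R :=
  ereal_sup [set (\int[mu]_x (uv.1 x)%:E + \int[nu]_x (uv.2 x)%:E)%E |
              uv in Kset b lambda c w1 w2 mu nu].

(* Main.v *)
(** Partition the tree into finitely many measurable cells on which the cost
    varies by at most [e] and on which the weights, truncated at a level [N],
    are constant up to [e].  The resulting finite problem is solved by maximizing its
    dual with a quadratic penalty for the constraint [u i + v j <= C i j]: the
    penalty derivatives at the maximum form an admissible plan satisfying
    complementary slackness.  The finite plan is spread over the cells as a
    combination of restrictions of the product measure, and the finite potentials
    become step functions.  Since the weights need not be integrable, the points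
    where they exceed [N] must be transported entirely; this holds once [N] is
    large, for otherwise a potential would reach [N] and make the dual value too
    small.  This argument needs both measures to be nonzero; when one of
    them vanishes, the empty plan is compared with truncated weights. *)

Require Import Defs.
From HB Require Import structures.
From mathcomp Require Import all_boot all_order all_algebra.
From mathcomp Require Import all_classical all_reals all_analysis.
From mathcomp Require Import measurable_realfun lra.
Import Order.TTheory GRing.Theory Num.Theory.
Import numFieldNormedType.Exports.
Local Open Scope classical_set_scope.
Local Open Scope ring_scope.

(** * Finite transport problems *)

(** The factor [(2 * eta)^-1] makes the derivative of the penalty in [u i] equal to the row sum of
    [max 0 (u i + v j - C i j) / eta]. *)
Definition penalized_dual {R : realType} {I J : finType} (m : I -> R) (n : J -> R)
    (C : I -> J -> R) (eta : R) (u : I -> R) (v : J -> R) : R :=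
  \sum_i u i * m i + \sum_j v j * n j
  - (2 * eta)^-1 * \sum_i \sum_j Num.max 0 (u i + v j - C i j) ^+ 2.

(** By this symmetry, optimality conditions proved for [u] transfer to [v]. *)
Lemma penalized_dualC {R : realType} {I J : finType} (m : I -> R) (n : J -> R)
    (C : I -> J -> R) (eta : R) (u : I -> R) (v : J -> R) :
  penalized_dual n m (fun j i => C i j) eta v u = penalized_dual m n C eta u v.
Proof.
rewrite /penalized_dual; congr (_ - _ * _); first exact: addrC.
rewrite exchange_big /=; by apply: eq_bigr => i _; apply: eq_bigr => j _; rewrite [v j + u i]addrC.
Qed.

Lemma continuous_sum_fun {R : realType} {X : topologicalType} {I : finType}
    (f : I -> X -> R) :
  (forall i, continuous (f i)) -> continuous (fun x => \sum_i f i x).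
Proof.
move=> cf; elim: (index_enum I) => [|i s IH] x.
  by under eq_fun do rewrite big_nil; exact: cst_continuous.
under eq_fun do rewrite big_cons.
exact: (continuousD (cf i x) (IH x)).
Qed.

Lemma continuous_penalized_dual {R : realType} {X : topologicalType} {I J : finType}
    (m : I -> R) (n : J -> R) (C : I -> J -> R) (eta : R)
    (U : X -> I -> R) (V : X -> J -> R) :
  (forall i, continuous (U ^~ i)) -> (forall j, continuous (V ^~ j)) ->
  continuous (fun x => penalized_dual m n C eta (U x) (V x)).
Proof.
move=> cU cV x; apply: cvgB; first apply: cvgD.
- apply: continuous_sum_fun => i {}x.
  by apply: cvgM; [exact: cU|exact: cst_continuous].
- apply: continuous_sum_fun => j {}x.
  by apply: cvgM; [exact: cV|exact: cst_continuous].
- apply: cvgM; first exact: cst_continuous.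
  apply: continuous_sum_fun => i; apply: continuous_sum_fun => j {}x.
  suff h : {for x, continuous (fun x => Num.max 0 (U x i + V x j - C i j))}.
    by under eq_fun do rewrite expr2; exact: cvgM.
  apply: (@continuous_max _ _ (fun=> 0)); first exact: cst_continuous.
  apply: cvgB; last exact: cst_continuous.
  by apply: cvgD; [exact: cU|exact: cV].
Qed.

(** A pair of potentials is a point of a product of segments over [I + J], compact by Tychonoff, on
    which the objective is continuous. The floor [- B] serves compactness. *)
Lemma penalized_dual_max {R : realType} {I J : finType} (m : I -> R) (n : J -> R)
    (C : I -> J -> R) (eta B : R) (a1 : I -> R) (a2 : J -> R) :
  (forall i, - B <= a1 i) -> (forall j, - B <= a2 j) ->
  exists u v,
    [/\ forall i, - B <= u i <= a1 i, forall j, - B <= v j <= a2 j &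
        forall u' v', (forall i, - B <= u' i <= a1 i) ->
          (forall j, - B <= v' j <= a2 j) ->
          penalized_dual m n C eta u' v' <= penalized_dual m n C eta u v].
Proof.
move=> Ba1 Ba2.
pose K (k : I + J) : set R := match k with
  | inl i => `[- B, a1 i]%classic | inr j => `[- B, a2 j]%classic end.
pose obj (z : prod_topology (fun _ : (I + J)%type => R : topologicalType)) :=
  penalized_dual m n C eta (z \o inl) (z \o inr).
have cproj (k : I + J) : continuous
    (fun z : prod_topology (fun _ : (I + J)%type => R : topologicalType) => (z k : R)).
  exact: (@proj_continuous (I + J)%type (fun=> R : topologicalType) k).
have cobj : continuous obj.
  by apply: continuous_penalized_dual => k; exact: cproj.
have cK : compact [set z : prod_topology (fun _ : (I + J)%type => R : topologicalType)
    | forall k, K k (z k)].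
  apply: (@tychonoff (I + J)%type (fun=> R : topologicalType)).
  by case=> k; exact: segment_compact.
have K0 : [set z : prod_topology (fun _ : (I + J)%type => R : topologicalType)
    | forall k, K k (z k)] !=set0.
  by exists (fun=> - B) => -[k|k] /=; rewrite in_itv /= lexx ?Ba1 ?Ba2.
have [z /set_mem Kz zmax] := compact_EVT_max K0 cK (continuous_subspaceT cobj).
exists (z \o inl), (z \o inr); split.
- by move=> i; have := Kz (inl i); rewrite /= in_itv.
- by move=> j; have := Kz (inr j); rewrite /= in_itv.
- move=> u' v' hu hv.
  pose z' (k : I + J) := match k with inl i => u' i | inr j => v' j end.
  have := zmax z'; apply; apply/mem_set => -[k|k] /=; rewrite in_itv /=.
    exact: hu.
  exact: hv.
Qed.

(* [s |-> max 0 s ^+ 2] has a 2-Lipschitz derivative. *)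
Lemma sqr_pos_smooth {R : realType} (s t : R) :
  Num.max 0 (s + t) ^+ 2 <= Num.max 0 s ^+ 2 + 2 * t * Num.max 0 s + t ^+ 2.
Proof. rewrite /Num.max; case: ltP => h1; case: ltP => h2; nra. Qed.

(** Stands in for a derivative: [sqr_pos_smooth], applied for each [j], bounds the change of the
    penalty by its first-order term plus a multiple of [t ^+ 2]. *)
Lemma penalized_dual_perturb {R : realType} {I J : finType} (m : I -> R) (n : J -> R)
    (C : I -> J -> R) (eta : R) (u : I -> R) (v : J -> R) (i : I) (t : R) :
  0 < eta ->
  penalized_dual m n C eta u v
    + t * (m i - \sum_j Num.max 0 (u i + v j - C i j) / eta)
    - t ^+ 2 * ((2 * eta)^-1 * #|J|%:R)
  <= penalized_dual m n C eta (fun k => if k == i then u i + t else u k) v.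
Proof.
move=> eta0; rewrite /penalized_dual.
rewrite [X in _ <= X + _ - _](bigD1 i) //= [X in X + _ - _ + _ - _ <= _](bigD1 i) //= eqxx.
rewrite [X in _ <= _ - _ * X](bigD1 i) //= [X in _ - _ * X + _ - _ <= _](bigD1 i) //= eqxx.
under [X in _ <= _ + X + _ - _]eq_bigr => k /negPf -> do [].
under [X in _ <= _ - _ * (_ + X)]eq_bigr => k /negPf -> do [].
have : \sum_j Num.max 0 (u i + t + v j - C i j) ^+ 2 <=
    \sum_j Num.max 0 (u i + v j - C i j) ^+ 2
    + 2 * t * \sum_j Num.max 0 (u i + v j - C i j) + #|J|%:R * t ^+ 2.
  have -> : #|J|%:R * t ^+ 2 = \sum_(j : J) t ^+ 2 by rewrite sumr_const mulr_natl.
  rewrite mulr_sumr -!big_split /=.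
  apply: ler_sum => j _.
  have -> : u i + t + v j - C i j = u i + v j - C i j + t by lra.
  exact: sqr_pos_smooth.
rewrite -[\sum_j _ / eta]mulr_suml.
set A := \sum_j Num.max 0 (u i + t + v j - C i j) ^+ 2.
set A' := \sum_j Num.max 0 (u i + v j - C i j) ^+ 2.
set G := \sum_j Num.max 0 (u i + v j - C i j).
set X := \sum_(k | k != i) u k * m k; set Y := \sum_j v j * n j; set Z := \sum_(k | k != i) \sum_j _ ^+ 2.
move=> h.
have e0 : 0 < (2 * eta)^-1 by rewrite invr_gt0; lra.
have -> : G / eta = 2 * (2 * eta)^-1 * G by rewrite invfM mulrA divff ?mul1r ?pnatr_eq0// mulrC.
move: e0; set e := (2 * eta)^-1 => e0.
have : e * A <= e * (A' + 2 * t * G + #|J|%:R * t ^+ 2) by rewrite ler_pM2l.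
nra.
Qed.

(** Maximality against moving [u i] alone by [t] gives [t * (m i - G) <= t ^+ 2 * K]. Small negative
    [t] yields [G <= m i]; small positive [t], available only below the ceiling [a1 i], yields the
    reverse. *)
Lemma penalized_dual_first_order {R : realType} {I J : finType} (m : I -> R) (n : J -> R)
    (C : I -> J -> R) (eta B : R) (a1 : I -> R) (u : I -> R) (v : J -> R) :
  0 < eta -> (forall i, 0 <= m i) ->
  (forall i j, - B + v j <= C i j) ->
  (forall i, - B <= u i <= a1 i) ->
  (forall u', (forall i, - B <= u' i <= a1 i) ->
     penalized_dual m n C eta u' v <= penalized_dual m n C eta u v) ->
  forall i, let G := \sum_j Num.max 0 (u i + v j - C i j) / eta in
    G <= m i /\ (u i < a1 i -> G = m i).
Proof.
move=> eta0 m0 hB hu umax i /=; set G := \sum_j _.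
pose K := (2 * eta)^-1 * #|J|%:R.
have K0 : 0 <= K by rewrite mulr_ge0// invr_ge0; lra.
have pert t : - B <= u i + t <= a1 i -> t * (m i - G) <= t ^+ 2 * K.
  move=> ht; have := penalized_dual_perturb m n C eta u v i t eta0.
  rewrite -/G -/K; have := umax (fun k => if k == i then u i + t else u k).
  have h k : - B <= (if k == i then u i + t else u k) <= a1 k.
    by case: eqP => [->|].
  by move=> /(_ h); lra.
have /andP[hu1 hu2] := hu i.
have D1 : 0 < 2 * K + 1 by lra.
(* the step [t] optimising the quadratic bound, cut to stay in the box *)
have up : u i < a1 i -> m i <= G.
  move=> ui; rewrite leNgt; apply/negP => mG.
  pose t := Num.min (a1 i - u i) ((m i - G) / (2 * K + 1)).
  have t0 : 0 < t.
    by rewrite lt_min subr_gt0 ui /= divr_gt0// subr_gt0.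
  have t1 : t <= a1 i - u i by rewrite ge_min lexx.
  have t2 : t * (2 * K + 1) <= m i - G by rewrite -ler_pdivlMr// ge_min lexx orbT.
  have := pert t; have -> : - B <= u i + t <= a1 i by apply/andP; split; lra.
  by move=> /(_ isT); nra.
have lo : G <= m i.
  (* At the floor no downward move is possible, but there the hypothesis on [B] makes every penalty
     term vanish, so [G = 0]. *)
  have [uB|uB] := leP (u i) (- B).
    rewrite (_ : G = 0) ?m0// /G big1// => j _.
    have := hB i j => h; rewrite max_l ?mul0r//; lra.
  rewrite leNgt; apply/negP => mG.
  pose t := Num.min (u i + B) ((G - m i) / (2 * K + 1)).
  have t0 : 0 < t.
    by rewrite lt_min divr_gt0 ?subr_gt0// andbT; lra.
  have t1 : t <= u i + B by rewrite ge_min lexx.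
  have t2 : t * (2 * K + 1) <= G - m i by rewrite -ler_pdivlMr// ge_min lexx orbT.
  have := pert (- t); have -> : - B <= u i - t <= a1 i by apply/andP; split; lra.
  by move=> /(_ isT); nra.
by split=> // ui; apply/eqP; rewrite eq_le lo up.
Qed.

(* The plan [g i j = max 0 (u i + v j - C i j) / eta] is read off a maximizer of
   the penalized dual: the optimality conditions are exactly admissibility and
   complementary slackness of [g]. *)
Lemma penalized_duality {R : realType} {I J : finType} (m : I -> R) (n : J -> R)
    (C : I -> J -> R) (eta M : R) (a1 : I -> R) (a2 : J -> R) :
  0 < eta -> 0 <= M ->
  (forall i, 0 <= m i) -> (forall j, 0 <= n j) ->
  (forall i, 0 <= a1 i) -> (forall j, 0 <= a2 j) ->
  (forall i j, `|C i j| <= M) ->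
  exists u v, let g i j := Num.max 0 (u i + v j - C i j) / eta in
    [/\ forall i, u i <= a1 i /\
          (\sum_j g i j <= m i /\ (u i < a1 i -> \sum_j g i j = m i)),
        forall j, v j <= a2 j /\
          (\sum_i g i j <= n j /\ (v j < a2 j -> \sum_i g i j = n j)),
        - M * \sum_i m i <= \sum_i u i * m i + \sum_j v j * n j &
        - M * \sum_j n j <= \sum_i u i * m i + \sum_j v j * n j].
Proof.
move=> eta0 M0 m0 n0 a10 a20 CM.
(* So large that [- B] plus any admissible value of the other potential is at most every [C i j];
   the floor then does not disturb the optimality conditions. *)
pose B := M + \sum_i a1 i + \sum_j a2 j.
have s1 : 0 <= \sum_i a1 i by exact: sumr_ge0.
have s2 : 0 <= \sum_j a2 j by exact: sumr_ge0.
have b1 i : a1 i <= \sum_i a1 i by rewrite (bigD1 i)//= lerDl sumr_ge0.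
have b2 i : a2 i <= \sum_i a2 i by rewrite (bigD1 i)//= lerDl sumr_ge0.
have MB : M <= B by rewrite /B; lra.
have C1 i j : - M <= C i j by have := CM i j; rewrite ler_norml => /andP[].
have [||u [v [hu hv uvmax]]] := @penalized_dual_max R I J m n C eta B a1 a2.
- by move=> i; have := a10 i; lra.
- by move=> i; have := a20 i; lra.
(* Feasible potentials carry no penalty, so the maximizer has at least their dual value. Testing
   with the constants [- M] and [0] gives the last two claims. *)
have val u' v' : (forall i, - B <= u' i <= a1 i) -> (forall j, - B <= v' j <= a2 j) ->
    (forall i j, u' i + v' j <= C i j) ->
    \sum_i u' i * m i + \sum_j v' j * n j <= \sum_i u i * m i + \sum_j v j * n j.
  move=> hu' hv' hC; have := uvmax _ _ hu' hv'; rewrite /penalized_dual.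
  rewrite [X in _ - _ * X <= _]big1; last first.
    move=> i _; rewrite big1// => j _; rewrite max_l ?expr0n//.
    by have := hC i j; lra.
  have : 0 <= (2 * eta)^-1 * \sum_i \sum_j Num.max 0 (u i + v j - C i j) ^+ 2.
    rewrite mulr_ge0 ?invr_ge0 //; first lra.
    by apply: sumr_ge0 => i _; apply: sumr_ge0 => j _; exact: sqr_ge0.
  lra.
exists u, v; split.
- move=> i; split; first by have /andP[] := hu i.
  apply: (@penalized_dual_first_order R I J m n C eta B a1 u v) => //.
  + move=> k j; have /andP[_ +] := hv j; have := C1 k j; have := b2 j.
    by rewrite /B; lra.
  + by move=> u' hu'; exact: uvmax.
- move=> j; split; first by have /andP[] := hv j.
  under eq_bigr do rewrite [u _ + _]addrC.
  apply: (@penalized_dual_first_order R J I n m (fun j i => C i j) eta B a2 v u) => //.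
  + move=> k i; have /andP[_ +] := hu i; have := C1 i k; have := b1 i.
    by rewrite /B; lra.
  + by move=> v' hv'; rewrite 2!(penalized_dualC m n); exact: uvmax.
- have := val (fun=> - M) (fun=> 0).
  rewrite /= -2!mulr_sumr mul0r !addr0; apply.
  + by move=> i; have := a10 i; move=> ?; apply/andP; split; lra.
  + by move=> i; have := a20 i; move=> ?; apply/andP; split; lra.
  + by move=> i j; have := C1 i j; lra.
- have := val (fun=> 0) (fun=> - M).
  rewrite /= -2!mulr_sumr mul0r !add0r; apply.
  + by move=> i; have := a10 i; move=> ?; apply/andP; split; lra.
  + by move=> i; have := a20 i; move=> ?; apply/andP; split; lra.
  + by move=> i j; have := C1 i j; lra.
Qed.

(* A cell with truncated cost [N] is fully transported: otherwise [u i >= N]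
   forces every [v j <= M + 1 - N], and the dual value drops below [- M * \sum_j n j]. *)
Lemma saturated_cell {R : realType} {I J : finType} (m : I -> R) (n : J -> R)
    (C : I -> J -> R) (g : I -> J -> R) (eta M N : R) (a1 u : I -> R) (v : J -> R) :
  (forall i, 0 <= m i) -> (forall j, 0 <= n j) ->
  (forall i j, `|C i j| <= M) ->
  (forall i, u i <= a1 i) -> (forall i j, u i + v j <= C i j + eta * g i j) ->
  (forall i j, eta * g i j <= 1) ->
  - M * \sum_j n j <= \sum_i u i * m i + \sum_j v j * n j ->
  \sum_i a1 i * m i < (N - 2 * M - 1) * \sum_j n j ->
  forall i, u i < N.
Proof.
move=> m0 n0 CM ua1 uv g1 val aN i; rewrite ltNge; apply/negP => Nu.
have vj j : v j <= M + 1 - N.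
  have := uv i j; have := g1 i j; have := ler_norm (C i j); have := CM i j; lra.
have : \sum_j v j * n j <= (M + 1 - N) * \sum_j n j.
  by rewrite mulr_sumr; apply: ler_sum => j _; rewrite ler_wpM2r.
have : \sum_i u i * m i <= \sum_i a1 i * m i.
  by apply: ler_sum => k _; rewrite ler_wpM2r.
nra.
Qed.

(** The violation of the constraint at [(i, j)] is at most [eta * g i j], and an entry of the plan
    never exceeds the total mass of [m]. Where [a1 i = N], saturation gives [u i < a1 i], hence full
    transport by complementary slackness. *)
Lemma finite_partial_duality {R : realType} {I J : finType} (m : I -> R) (n : J -> R)
    (C : I -> J -> R) (eta M N : R) (a1 : I -> R) (a2 : J -> R) :
  0 < eta -> 0 <= M -> eta * \sum_i m i <= 1 ->
  (forall i, 0 <= m i) -> (forall j, 0 <= n j) ->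
  (forall i, 0 <= a1 i) -> (forall j, 0 <= a2 j) ->
  (forall i j, `|C i j| <= M) ->
  \sum_i a1 i * m i < (N - 2 * M - 1) * \sum_j n j ->
  \sum_j a2 j * n j < (N - 2 * M - 1) * \sum_i m i ->
  exists u v (g : I -> J -> R),
    [/\ forall i, u i <= a1 i, forall j, v j <= a2 j &
        forall i j, u i + v j <= C i j + eta * \sum_i m i] /\
    [/\ forall i j, 0 <= g i j,
        forall i, \sum_j g i j <= m i /\ (a1 i = N -> \sum_j g i j = m i),
        forall j, \sum_i g i j <= n j /\ (a2 j = N -> \sum_i g i j = n j) &
        \sum_i a1 i * (m i - \sum_j g i j) + \sum_j a2 j * (n j - \sum_i g i j)
          + \sum_i \sum_j C i j * g i j
        <= \sum_i u i * m i + \sum_j v j * n j].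
Proof.
move=> eta0 M0 etam m0 n0 a10 a20 CM sat1 sat2.
have [u [v [hu hv val1 val2]]] := penalized_duality m n C eta M a1 a2 eta0 M0 m0 n0 a10 a20 CM.
pose g i j := Num.max 0 (u i + v j - C i j) / eta.
have gE i j : eta * g i j = Num.max 0 (u i + v j - C i j).
  by rewrite mulrC divfK // gt_eqF.
have g0 i j : 0 <= g i j by rewrite divr_ge0 ?le_max ?lexx // ltW.
have gm i j : eta * g i j <= eta * \sum_i m i.
  rewrite ler_pM2l //; apply: (@le_trans _ _ (\sum_j g i j)).
    by rewrite (bigD1 j) //= lerDl sumr_ge0.
  apply: le_trans (hu i).2.1 _; by rewrite (bigD1 i) //= lerDl sumr_ge0.
have uv i j : u i + v j <= C i j + eta * g i j.
  have : u i + v j - C i j <= Num.max 0 (u i + v j - C i j) by rewrite le_max lexx orbT.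
  by rewrite gE; lra.
have g1 i j : eta * g i j <= 1 by exact: le_trans (gm i j) etam.
have uN := @saturated_cell _ _ _ m n C g eta M N a1 u v m0 n0 CM (fun i => (hu i).1) uv g1 val2 sat1.
have vN : forall j, v j < N.
  apply: (@saturated_cell _ _ _ n m (fun j i => C i j) (fun j i => g i j) eta M N a2 v u) => //.
  - by move=> j; exact: (hv j).1.
  - by move=> j i; rewrite [v j + _]addrC.
  - by rewrite addrC.
exists u, v, g; split; split.
- by move=> i; exact: (hu i).1.
- by move=> j; exact: (hv j).1.
- by move=> i j; apply: le_trans (uv i j) _; rewrite lerD2l.
- exact: g0.
- move=> i; have [_ [h1 h2]] := hu i; split; [exact: h1|by move=> aN; apply: h2; rewrite aN; exact: uN].
- move=> j; have [_ [h1 h2]] := hv j; split; [exact: h1|by move=> aN; apply: h2; rewrite aN; exact: vN].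
- have slack1 i : a1 i * (m i - \sum_j g i j) = u i * (m i - \sum_j g i j).
    have [ua [_ h]] := hu i; move: ua; rewrite le_eqVlt => /orP[/eqP -> //|/h ->].
    by rewrite subrr !mulr0.
  have slack2 j : a2 j * (n j - \sum_i g i j) = v j * (n j - \sum_i g i j).
    have [va [_ h]] := hv j; move: va; rewrite le_eqVlt => /orP[/eqP -> //|/h ->].
    by rewrite subrr !mulr0.
  (* The plan lives where [C i j <= u i + v j], so its cost is at most the integral of the
     potentials against its marginals. *)
  have : \sum_i \sum_j C i j * g i j <= \sum_i u i * (\sum_j g i j) + \sum_j v j * (\sum_i g i j).
    under [X in _ <= X + _]eq_bigr do rewrite mulr_sumr.
    under [X in _ <= _ + X]eq_bigr do rewrite mulr_sumr.
    rewrite [X in _ <= _ + X]exchange_big -big_split /=; apply: ler_sum => i _.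
    rewrite -big_split /=; apply: ler_sum => j _; rewrite -mulrDl.
    have [uvC|uvC] := leP (C i j) (u i + v j); first by rewrite ler_wpM2r.
    have -> : g i j = 0; last by rewrite !mulr0.
    by apply: (mulfI (lt0r_neq0 eta0)); rewrite gE mulr0 max_l // subr_le0 ltW.
  move=> hC; under eq_bigr do rewrite slack1 mulrBr.
  under [X in _ + X + _]eq_bigr do rewrite slack2 mulrBr.
  rewrite !sumrB; lra.
Qed.

(** * Finite partitions of metric trees *)

Lemma measurable_fun_ltset {R : realType} {d : measure_display} {T : measurableType d}
    (f : T -> R) :
  (forall r, measurable [set x | f x < r]) -> measurable_fun setT f.
Proof.
move=> mf _; apply: (measurability _ (RGenInftyO.measurableE R)) => //.
move=> _ [_ [r ->] <-]; rewrite setTI; exact: mf.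
Qed.

(** If [f x < r], then for fine enough tolerance the whole cell of [x] lies in the sublevel set,
    which is therefore a countable union of cells. *)
Lemma measurable_fun_small_oscillation {R : realType} {d : measure_display}
    {T : measurableType d} (f : T -> R) :
  (forall e, 0 < e -> exists (F : finType) (phi : T -> F),
     (forall i, measurable (phi @^-1` [set i])) /\
     (forall x y, phi x = phi y -> f y <= f x + e)) ->
  measurable_fun setT f.
Proof.
move=> H; apply: measurable_fun_ltset => r.
have e0 (k : nat) : (0 : R) < k.+1%:R^-1 by rewrite invr_gt0.
pose F k := projT1 (cid (H _ (e0 k))).
pose phi k : T -> F k := projT1 (cid (projT2 (cid (H _ (e0 k))))).
have mphi k i : measurable (phi k @^-1` [set i]).
  exact: (projT2 (cid (projT2 (cid (H _ (e0 k)))))).1.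
have osc k x y : phi k x = phi k y -> f y <= f x + k.+1%:R^-1.
  exact: (projT2 (cid (projT2 (cid (H _ (e0 k)))))).2.
have -> : [set x | f x < r] = \bigcup_k \bigcup_(i in
    [set i | phi k @^-1` [set i] `<=` [set x | f x < r]]) phi k @^-1` [set i].
  apply/seteqP; split => x /=.
    move=> /ltr_add_invr[k hk]; exists k => //; exists (phi k x) => //= y /= yx.
    exact: le_lt_trans (osc k x y (esym yx)) hk.
  by move=> [k _ [i /= hi hx]]; exact: hi.
by apply: bigcupT_measurable => k; exact: fin_bigcup_measurable.
Qed.

(** Each point goes to the first set containing it, so a fibre is one set minus the earlier ones. *)
Lemma finite_cover_partition {d : measure_display} {T : measurableType d}
    {F : finType} (E : F -> set T) :
  (forall i, measurable (E i)) -> (forall x, exists i, E i x) ->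
  exists phi : T -> F,
    (forall i, measurable (phi @^-1` [set i])) /\ forall x, E (phi x) x.
Proof.
move=> mE cE.
pose phi x := [arg min_(i < projT1 (cid (cE x)) | `[< E i x >]) enum_rank i].
have phiP x : E (phi x) x /\ forall j, E j x -> (enum_rank (phi x) <= enum_rank j)%N.
  rewrite /phi; case: arg_minnP => [|i /asboolP Ei imin].
    by apply/asboolP; exact: (projT2 (cid (cE x))).
  by split=> // j Ej; apply: imin; exact/asboolP.
exists phi; split=> [i|x]; last by have [] := phiP x.
have -> : phi @^-1` [set i] =
    E i `\` \bigcup_(j in [set j | (enum_rank j < enum_rank i)%N]) E j.
  apply/seteqP; split => x /=.
    move=> <-; have [Ex xmin] := phiP x; split=> // -[j /= ji /xmin].
    by rewrite leqNgt ji.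
  move=> [Ei Ej]; have [Ex xmin] := phiP x.
  apply: enum_rank_inj; apply/val_inj/eqP; rewrite eqn_leq xmin//= leqNgt.
  by apply/negP => h; apply: Ej; exists (phi x).
by apply: measurableD => //; apply: fin_bigcup_measurable => //; exact: finite_finset.
Qed.

Definition on_segment {R : realType} {T : Type} (dist : T -> T -> R) (p : T * T) (x : T) :=
  dist p.1 x + dist x p.2 = dist p.1 p.2.

(* By the four-point condition a segment of a 0-hyperbolic space is isometric
   to an interval through the distance to its first endpoint. *)
Lemma on_segment_dist {R : realType} {T : Type} (dist : T -> T -> R) (p : T * T) (x y : T) :
  is_metric dist ->
  (forall x y z w, dist x y + dist z w <=
     Num.max (dist x z + dist y w) (dist x w + dist y z)) ->
  on_segment dist p x -> on_segment dist p y ->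
  dist x y <= `|dist p.1 x - dist p.1 y|.
Proof.
move=> [_ _ sym _] four; rewrite /on_segment => hx hy.
have := four x y p.1 p.2; rewrite (sym x p.1) (sym y p.1) le_max.
have := ler_norm (dist p.1 x - dist p.1 y).
have := ler_norm (dist p.1 y - dist p.1 x); rewrite distrC.
by move=> h1 h2 /orP[]; lra.
Qed.

(** Compactness is borrowed from real intervals: [on_segment_dist] parametrizes each segment
    isometrically by the distance to its first node. A pair of segments becomes a compact rectangle,
    which yields one [delta], and there are finitely many pairs. *)
Lemma finite_metric_tree_uniformly_continuous {R : realType} {T : Type}
    (dist : T -> T -> R) (c : T -> T -> R) :
  finite_metric_tree dist -> continuous2_wrt dist c ->
  forall e, 0 < e -> exists2 delta, 0 < delta &
    forall x y x' y', dist x x' < delta -> dist y y' < delta ->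
      `|c x' y' - c x y| < e.
Proof.
move=> [metric geo four [n [V cover]]] hc e e0.
have [dist0 _ sym tri] := metric.
pose seg (ij : 'I_n * 'I_n) := (V ij.1, V ij.2).
pose good delta x y := forall x' y', dist x x' < delta -> dist y y' < delta ->
  `|c x' y' - c x y| < e.
have key (p : ('I_n * 'I_n) * ('I_n * 'I_n)) : \forall delta \near (0:R)^'+,
    forall x y, on_segment dist (seg p.1) x -> on_segment dist (seg p.2) y ->
    good delta x y.
  pose P delta (z : R * R) := forall x y,
    on_segment dist (seg p.1) x -> on_segment dist (seg p.2) y ->
    dist (seg p.1).1 x = z.1 -> dist (seg p.2).1 y = z.2 -> good delta x y.
  have segle (q : 'I_n * 'I_n) x : on_segment dist (seg q) x ->
      dist (seg q).1 x \in `[0, dist (seg q).1 (seg q).2].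
    by rewrite /on_segment /= => h; rewrite in_itv /= dist0 -h lerDl dist0.
  have /compact_near_coveringP cK := compact_setX
    (@segment_compact R 0 (dist (seg p.1).1 (seg p.1).2))
    (@segment_compact R 0 (dist (seg p.2).1 (seg p.2).2)).
  apply: filterS (cK R (0^'+) P _ _) => [delta h x y hx hy|].
    by apply: (h (dist (seg p.1).1 x, dist (seg p.2).1 y)) => //; split => /=; exact: segle.
  move=> [s t] [/= hs ht]; move: hs ht; rewrite !in_itv /= => /andP[s0 s1] /andP[t0 t1].
  (* Geodesicity realizes the parameters [s] and [t] by actual points, at which the continuity of
     [c] applies. *)
  have [x0 [x0s x0e]] := geo _ _ _ s0 s1.
  have [y0 [y0t y0e]] := geo _ _ _ t0 t1.
  have e20 : 0 < e / 2 by lra.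
  have [r [r0 hr]] := hc x0 y0 _ e20.
  have r20 : 0 < r / 2 by lra.
  have close q x z : on_segment dist (seg q) x -> on_segment dist (seg q) z ->
      ball (dist (seg q).1 z) (r / 2) (dist (seg q).1 x) -> dist z x < r / 2.
    by move=> hx hz hb; apply: le_lt_trans hb; exact: (on_segment_dist dist (seg q)).
  exists (ball (s, t) (r / 2), [set delta | delta < r / 2]).
    by split => /=; [exact: nbhsx_ballx|exact: nbhs_right_lt].
  move=> [[s' t'] delta] [/= [/= hs' ht'] hdelta] x y hx hy /= xs' yt' x' y' xx' yy'.
  have xx0 : dist x0 x < r / 2.
    by apply: (close p.1) => //; rewrite ?x0s ?xs'// /on_segment x0s x0e; lra.
  have yy0 : dist y0 y < r / 2.
    by apply: (close p.2) => //; rewrite ?y0t ?yt'// /on_segment y0t y0e; lra.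
  have := hr x y; have := hr x' y'.
  have := tri x0 x x'; have := tri y0 y y'.
  move=> h1 h2 h3 h4.
  have {}h3 : `|c x' y' - c x0 y0| < e / 2 by apply: h3; lra.
  have {}h4 : `|c x y - c x0 y0| < e / 2 by apply: h4; lra.
  rewrite (_ : _ - _ = (c x' y' - c x0 y0) - (c x y - c x0 y0)); last by lra.
  by apply: le_lt_trans (ler_normB _ _) _; lra.
have allkey : \forall delta \near (0 : R)^'+, forall p x y,
    on_segment dist (seg p.1) x -> on_segment dist (seg p.2) y -> good delta x y.
  exact: (@filter_forall _ _ (fun p delta => forall x y, on_segment dist (seg p.1) x ->
    on_segment dist (seg p.2) y -> good delta x y)).
have [delta [/= delta0 hdelta]] := filter_ex (filterI (nbhs_right_gt (0 : R)) allkey).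
exists delta => // x y; have [i [j hij]] := cover x; have [k [l hkl]] := cover y.
exact: (hdelta ((i, j), (k, l))).
Qed.

(** Each segment is cut into pieces of length [e / 2] by the distance to its first node; the
    isometry bounds their diameters. Pieces of different segments may overlap, which
    [finite_cover_partition] repairs. *)
Lemma finite_metric_tree_partition {R : realType} {d : measure_display}
    {T : measurableType d} (dist : T -> T -> R) :
  finite_metric_tree dist -> borel_wrt dist ->
  forall e, 0 < e -> exists (F : finType) (phi : T -> F),
    (forall i, measurable (phi @^-1` [set i])) /\
    forall x y, phi x = phi y -> dist x y < e.
Proof.
move=> [metric _ four [n [V cover]]] borel e e0.
have [dist0 _ sym tri] := metric.
have mdist a : measurable_fun setT (dist a).
  apply: measurable_fun_ltset => r; rewrite borel.
  apply: sub_sigma_algebra => x /= hx; exists (r - dist a x); split; first lra.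
  by move=> y hy; have := tri a x y; lra.
pose L : R := \sum_(p : 'I_n * 'I_n) dist (V p.1) (V p.2).
have e20 : 0 < e / 2 by lra.
(* [L] bounds the length of every segment; the successor leaves room for the piece starting at the
   last multiple of [e / 2] below [L]. *)
pose K := (Num.truncn (L / (e / 2))).+1.
pose E (k : ('I_n * 'I_n) * 'I_K) :=
  [set x | on_segment dist (V k.1.1, V k.1.2) x] `&`
  dist (V k.1.1) @^-1` `[k.2%:R * (e / 2), k.2.+1%:R * (e / 2)[%classic.
have [k|x|phi [mphi Ephi]] := @finite_cover_partition d T _ E.
- apply: measurableI; last first.
    by rewrite -[_ @^-1` _]setTI; exact: mdist.
  have mf : measurable_fun setT (fun x => dist (V k.1.1) x + dist (V k.1.2) x).
    exact: measurable_funD.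
  have := mf measurableT [set dist (V k.1.1) (V k.1.2)]; rewrite setTI.
  move=> /(_ (measurable_set1 _)); congr measurable.
  by apply/seteqP; split => x /=; rewrite /on_segment /= (sym x).
- have [i [j hij]] := cover x.
  have xL : dist (V i) x <= L.
    apply: (@le_trans _ _ (dist (V i) (V j))); first by rewrite -hij lerDl.
    by rewrite /L (bigD1 (i, j)) //= lerDl sumr_ge0.
  have /truncn_itv /andP[k1 k2] : 0 <= dist (V i) x / (e / 2).
    by rewrite divr_ge0 // ltW.
  have kK : (Num.truncn (dist (V i) x / (e / 2)) < K)%N.
    by rewrite ltnS; apply: le_truncn; rewrite ler_pM2r // invr_gt0.
  exists ((i, j), Ordinal kK); split => //=; rewrite in_itv /=.
  by rewrite -ler_pdivlMr // k1 -ltr_pdivrMr.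
- exists (('I_n * 'I_n) * 'I_K)%type, phi; split => // x y xy.
  have [hx] := Ephi x; rewrite /= in_itv /= => /andP[x1 x2].
  have := Ephi y; rewrite -xy /= => -[hy]; rewrite /= in_itv /= => /andP[y1 y2].
  apply: le_lt_trans (on_segment_dist dist _ x y metric four hx hy) _ => /=.
  by move: x2 y2; rewrite -natr1 mulrDl mul1r ltr_norml => x2 y2; apply/andP; split; lra.
Qed.

(** * Step functions, densities and marginals *)

(** An alias carrying the finiteness proof as an argument, so that a finite measure structure can be
    attached to it. *)
Definition finite_copy {R : realType} {d : measure_display} {T : measurableType d}
  (mu : {measure set T -> \bar R}) (_ : fin_num_fun mu) : set T -> \bar R := mu.

HB.instance Definition _ (R : realType) (d : measure_display) (T : measurableType d)
  (mu : {measure set T -> \bar R}) (finmu : fin_num_fun mu) :=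
  Measure.copy (finite_copy mu finmu) mu.

HB.instance Definition _ (R : realType) (d : measure_display) (T : measurableType d)
  (mu : {measure set T -> \bar R}) (finmu : fin_num_fun mu) :=
  Measure_isFinite.Build d T R (finite_copy mu finmu) finmu.

Section finite_partition.
Context {R : realType} {d : measure_display} {T : measurableType d} {F : finType}.
Variables (phi : T -> F) (mphi : forall i, measurable (phi @^-1` [set i])).

Lemma step_indicE (s : F -> R) x : s (phi x) = \sum_i s i * \1_(phi @^-1` [set i]) x.
Proof.
rewrite (bigD1 (phi x)) //= indicE mem_set // mulr1 big1 ?addr0 // => i ix.
by rewrite indicE memNset ?mulr0 //= => xi; rewrite xi eqxx in ix.
Qed.

Lemma measurable_step (s : F -> R) : measurable_fun setT (s \o phi).
Proof.
apply: measurable_fun_ltset => r.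
have -> : [set x | (s \o phi) x < r] = \bigcup_(i in [set i | s i < r]) phi @^-1` [set i].
  by apply/seteqP; split => x /=; [move=> h; exists (phi x)|move=> [i /= + ->]].
exact: fin_bigcup_measurable.
Qed.

Lemma integrable_step (mu : {finite_measure set T -> \bar R}) (s : F -> R) :
  mu.-integrable setT (EFin \o (s \o phi)).
Proof.
apply: measurable_bounded_integrable => //.
- by rewrite -ge0_fin_numE // fin_num_measure.
- exact: measurable_step.
- exists (\sum_i `|s i|); split; first by rewrite num_real.
  move=> M hM x _ /=; apply: le_trans (ltW hM).
  by rewrite (bigD1 (phi x)) //= lerDl sumr_ge0.
Qed.

Lemma integral_step (mu : {finite_measure set T -> \bar R}) (s : F -> R) (A : set T) :
  measurable A ->
  (\int[mu]_(x in A) (s (phi x))%:E =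
   (\sum_i s i * fine (mu (A `&` phi @^-1` [set i])))%:E)%E.
Proof.
move=> mA.
have iind i : mu.-integrable A (fun x => (\1_(phi @^-1` [set i]) x)%:E).
  by apply: (@integrableS _ _ _ _ setT) => //; exact: integrable_indic.
under eq_integral do rewrite step_indicE -sumEFin.
rewrite integral_sum //; last first.
  by move=> i; under eq_fun do rewrite EFinM; exact: integrableZl.
rewrite -sumEFin; apply: eq_bigr => i _.
under eq_integral do rewrite EFinM.
rewrite integralZl // integral_indic // setIC EFinM fineK // fin_num_measure //.
exact: measurableI.
Qed.

Lemma sum_measure_fibers (mu : {finite_measure set T -> \bar R}) (A : set T) :
  measurable A -> (mu A = (\sum_i fine (mu (A `&` phi @^-1` [set i])))%:E)%E.
Proof.
move=> mA; have := integral_step mu (fun=> 1) A mA.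
rewrite integral_cst // mul1e => ->.
by congr EFin; apply: eq_bigr => i _; rewrite mul1r.
Qed.

(** The measure is the sum, over pairs of cells, of the product measure restricted to the pair and
    scaled by [h]; it is assembled by recursion on the list of pairs. *)
Lemma step_coupling (mu nu : {finite_measure set T -> \bar R}) (h : F -> F -> R) :
  (forall i j, 0 <= h i j) ->
  exists gamma : {finite_measure set (T * T)%type -> \bar R},
    forall A B, measurable A -> measurable B ->
      gamma (A `*` B) = (\sum_i \sum_j h i j *
        (fine (mu (A `&` phi @^-1` [set i])) * fine (nu (B `&` phi @^-1` [set j]))))%:E.
Proof.
move=> h0.
pose P (p : F * F) := (phi @^-1` [set p.1]) `*` (phi @^-1` [set p.2]).
have mP p : measurable (P p) by exact: measurableX.
have munu_fin D : measurable D -> (mu \x nu)%E D \is a fin_num.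
  move=> mD; rewrite ge0_fin_numE //.
  apply: (@le_lt_trans _ _ ((mu \x nu)%E setT)).
    by apply: le_measure => //; rewrite inE.
  rewrite -setXTT product_measure1E // ltey_eq fin_numM //; exact: fin_num_measure.
have [g gE] : exists g : {measure set (T * T)%type -> \bar R}, forall D, measurable D ->
    g D = (\sum_(p <- index_enum (F * F)%type)
      (h p.1 p.2)%:E * (mu \x nu) (D `&` P p))%E.
  elim: (index_enum _) => [|p s [g gE]].
    by exists mzero => D mD; rewrite big_nil.
  exists (measure_add (mscale (NngNum (h0 p.1 p.2)) (mrestr (mu \x nu)%E (mP p))) g) => D mD.
  rewrite big_cons -gE //; exact: (etrans (measure_addE _ _ _)).
have gfin : fin_num_fun g.
  move=> D mD; rewrite gE //; apply: (big_ind (fun x => x \is a fin_num)) => // [x y|p _].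
    by rewrite fin_numD => -> ->.
  rewrite fin_numM // munu_fin //.
  exact: measurableI.
exists (finite_copy g gfin) => A B mA mB.
rewrite [LHS]gE; last exact: measurableX.
rewrite pair_big /= -sumEFin; apply: eq_bigr => -[i j] _ /=.
rewrite -setXI product_measure1E; [|exact: measurableI..].
by rewrite EFinM; congr (_ * _)%E; rewrite EFinM !fineK // fin_num_measure //; exact: measurableI.
Qed.

End finite_partition.

(** * Image measures, their densities and one-sided duality *)

Section marginal.
Context {R : realType} {d d' : measure_display} {X : measurableType d} {T : measurableType d'}.
Variables (p : X -> T) (mp : measurable_fun setT p) (gamma : {finite_measure set X -> \bar R}).

Definition marginal : set T -> \bar R := pushforward gamma p.

Let marginal0 : marginal set0 = 0%E.
Proof. exact: measure0. Qed.

Let marginal_ge0 A : (0 <= marginal A)%E.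
Proof. exact: measure_ge0. Qed.

Let marginal_sigma_additive : semi_sigma_additive marginal.
Proof. exact: measure_semi_sigma_additive. Qed.

HB.instance Definition _ := isMeasure.Build _ _ _ marginal
  marginal0 marginal_ge0 marginal_sigma_additive.

Let marginal_fin : fin_num_fun marginal.
Proof.
by move=> A mA; apply: fin_num_measure; rewrite -[_ @^-1` _]setTI; exact: mp.
Qed.

HB.instance Definition _ := Measure_isFinite.Build _ _ _ marginal marginal_fin.

End marginal.

(** The density [f] and the Radon-Nikodym derivative have equal integrals over every measurable set,
    so they agree almost everywhere; then change variables. *)
Lemma integral_density {R : realType} {d : measure_display} {T : measurableType d}
    (mu nu : {finite_measure set T -> \bar R}) (f u : T -> R) :
  measurable_fun setT f -> (forall x, 0 <= f x) ->
  (forall A, measurable A -> nu A = \int[mu]_(x in A) (f x)%:E)%E ->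
  nu.-integrable setT (EFin \o u) ->
  (\int[nu]_x (u x)%:E = \int[mu]_x (u x * f x)%:E)%E.
Proof.
move=> mf f0 nuE intu.
have dom : nu `<< mu.
  apply/null_content_dominatesP => A mA muA; rewrite nuE // null_set_integral //.
  exact/measurable_EFinP/measurable_funTS.
rewrite -(Radon_Nikodym_change_of_variables dom measurableT intu).
have intRN := @Radon_Nikodym_integrable _ _ _ (charge_of_finite_measure nu) mu dom.
have mu_ := measurable_int _ intu; have mRN := measurable_int _ intRN.
apply: ae_eq_integral => //.
- exact: emeasurable_funM.
- by apply/measurable_EFinP; apply: measurable_funM => //; exact/measurable_EFinP.
have -> : (fun x => (u x * f x)%:E) = ((EFin \o u) \* (EFin \o f))%E.
  by apply/funext => x; rewrite /= EFinM.
apply: ae_eqe_mul2l; apply: integral_ae_eq => //.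
  exact/measurable_EFinP.
by move=> E _ mE; rewrite -nuE // -(@Radon_Nikodym_integral _ _ _ (charge_of_finite_measure nu)).
Qed.

(** On the set where [f > 1], the positive function [f - 1] has integral at most zero, because the
    finite mass of that set can be subtracted. *)
Lemma density_le1 {R : realType} {d : measure_display} {T : measurableType d}
    (mu : {finite_measure set T -> \bar R}) (f : T -> R) :
  measurable_fun setT f -> (forall x, 0 <= f x) ->
  (forall A, measurable A -> \int[mu]_(x in A) (f x)%:E <= mu A)%E ->
  {ae mu, forall x, f x <= 1}.
Proof.
move=> mf f0 fmu.
pose A := [set x | 1 < f x].
have mA : measurable A.
  have := mf measurableT `]1, +oo[%classic (measurable_itv _); rewrite setTI.
  by congr measurable; apply/seteqP; split => x /=; rewrite in_itv /= andbT.
have mfA : measurable_fun A (fun x => (f x - 1)%:E).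
  apply/measurable_EFinP; apply: measurable_funTS; exact: measurable_funB.
have : (\int[mu]_(x in A) `|(f x - 1)%:E| = 0)%E.
  have := fmu A mA.
  have -> : (\int[mu]_(x in A) (f x)%:E =
      \int[mu]_(x in A) `|(f x - 1)%:E| + \int[mu]_(x in A) cst 1 x)%E.
    rewrite -ge0_integralD //=; last first.
      by apply/measurable_EFinP; apply: measurableT_comp => //; exact/measurable_EFinP.
    apply: eq_integral => x /set_mem /= fx.
    by rewrite gtr0_norm ?subr_gt0 // -EFinD subrK.
  rewrite (integral_cst mu mA 1) mul1e => h.
  apply/eqP; rewrite eq_le integral_ge0 // andbT.
  by rewrite -(leeD2rE _ _ (fin_num_measure mu A mA)) add0e.
move/(ae_eq_integral_abs mu mA mfA); apply: filterS => x /= h.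
rewrite leNgt; apply/negP => fx; have := h fx => -[]; lra.
Qed.

(** One half of weak duality, stated for a map [p] so as to serve both projections. Split [u] as
    [u * f + u * (1 - f)]: the first part integrates to [u \o p] against [gamma], the second is
    dominated by [w * (1 - f)] since [f <= 1] almost everywhere. *)
Lemma marginal_duality {R : realType} {d d' : measure_display} {X : measurableType d}
    {T : measurableType d'} (p : X -> T) (mu : {finite_measure set T -> \bar R})
    (gamma : {finite_measure set X -> \bar R}) (f u w : T -> R) :
  measurable_fun setT p -> measurable_fun setT f -> measurable_fun setT w ->
  (forall x, 0 <= f x) -> (forall x, 0 <= w x) -> (forall x, u x <= w x) ->
  (forall A, measurable A -> gamma (p @^-1` A) <= mu A)%E ->
  (forall A, measurable A -> gamma (p @^-1` A) = \int[mu]_(x in A) (f x)%:E)%E ->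
  mu.-integrable setT (EFin \o u) ->
  [/\ gamma.-integrable setT (EFin \o (u \o p)),
      (0 <= \int[mu]_x (w x * (1 - f x))%:E)%E &
      (\int[mu]_x (u x)%:E <=
        \int[gamma]_z (u (p z))%:E + \int[mu]_x (w x * (1 - f x))%:E)%E].
Proof.
move=> mp mf mw f0 w0 uw le_mu densE intu.
have mu_ : measurable_fun setT u by exact/measurable_EFinP/(measurable_int _ intu).
have intup : gamma.-integrable setT (EFin \o (u \o p)).
  apply/integrableP; split; first exact/measurable_EFinP/measurableT_comp.
  have /integrableP[_] := intu; apply: le_lt_trans.
  have -> : (\int[gamma]_x `|(EFin \o (u \o p)) x| =
      \int[marginal p gamma]_x `|(EFin \o u) x|)%E.
    rewrite ge0_integral_pushforward //.
    exact/measurableT_comp/measurable_EFinP.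
  apply: (@ge0_le_measure_integral _ _ _ (marginal p gamma : {measure set T -> \bar R})) => //.
  exact/measurableT_comp/measurable_EFinP.
have intum : (marginal p gamma).-integrable setT (EFin \o u).
  by apply: integrable_pushforward => //; exact/measurable_EFinP.
have dens : (\int[gamma]_z (u (p z))%:E = \int[mu]_x (u x * f x)%:E)%E.
  rewrite -(@integral_density _ _ _ mu (marginal p gamma : {finite_measure set T -> \bar R})) //.
  by rewrite integral_pushforward //; exact/measurable_EFinP.
(* The bound [f <= 1] holds only almost everywhere; its truncation satisfies it at every point and
   has the same integrals. *)
pose g x := Num.min (f x) 1.
have mg : measurable_fun setT g by exact: measurable_minr.
have g01 x : 0 <= g x <= 1 by rewrite /g le_min f0 ler01 ge_min lexx orbT.
have fg : {ae mu, forall x, f x = g x}.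
  have := @density_le1 _ _ _ mu f mf f0; have h A : measurable A ->
      (\int[mu]_(x in A) (f x)%:E <= mu A)%E by move=> mA; rewrite -densE // le_mu.
  by move=> /(_ h); apply: filterS => x fx; rewrite /g min_l.
have -> : (\int[mu]_x (w x * (1 - f x))%:E = \int[mu]_x (w x * (1 - g x))%:E)%E.
  apply: ae_eq_integral => //.
  - by apply/measurable_EFinP; apply: measurable_funM => //; exact: measurable_funB.
  - by apply/measurable_EFinP; apply: measurable_funM => //; exact: measurable_funB.
  - by apply: filterS fg => x -> _.
have -> : (\int[gamma]_z (u (p z))%:E = \int[mu]_x (u x * g x)%:E)%E.
  rewrite dens; apply: ae_eq_integral => //.
  - by apply/measurable_EFinP; exact: measurable_funM.
  - by apply/measurable_EFinP; exact: measurable_funM.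
  - by apply: filterS fg => x -> _.
have mwg : measurable_fun setT (EFin \o (fun x => w x * (1 - g x))).
  by apply/measurable_EFinP; apply: measurable_funM => //; exact: measurable_funB.
have wg0 x : 0 <= w x * (1 - g x).
  by rewrite mulr_ge0 // subr_ge0; have /andP[] := g01 x.
have intug : mu.-integrable setT (EFin \o (fun x => u x * g x)).
  apply: (le_integrable measurableT _ _ intu).
    by apply/measurable_EFinP; exact: measurable_funM.
  move=> x _ /=; rewrite lee_fin normrM ler_piMr //.
  by have /andP[h1 h2] := g01 x; rewrite ger0_norm.
have intu1g : mu.-integrable setT (EFin \o (fun x => u x * (1 - g x))).
  apply: (le_integrable measurableT _ _ intu).
    by apply/measurable_EFinP; apply: measurable_funM => //; exact: measurable_funB.
  move=> x _ /=; rewrite lee_fin normrM ler_piMr //.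
  by have /andP[h1 h2] := g01 x; rewrite ger0_norm; lra.
have W0 : (0 <= \int[mu]_x (w x * (1 - g x))%:E)%E.
  by apply: integral_ge0 => x _; rewrite lee_fin.
split => //.
have -> : (\int[mu]_x (u x)%:E =
    \int[mu]_x (u x * g x)%:E + \int[mu]_x (u x * (1 - g x))%:E)%E.
  rewrite -integralD_EFin //; apply: eq_integral => x _ /=.
  by rewrite -EFinD; congr EFin; lra.
apply: leeD => //.
(* The weight may fail to be integrable; the right-hand side is then infinite. *)
have [intw|nintw] := pselect (mu.-integrable setT (EFin \o (fun x => w x * (1 - g x)))).
  apply: le_integral => // x _; rewrite lee_fin ler_wpM2r //.
  by have /andP[] := g01 x; rewrite subr_ge0.
suff -> : (\int[mu]_x (w x * (1 - g x))%:E = +oo)%E by rewrite leey.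
apply/eqP; apply: contra_notT nintw => woo.
apply/integrableP; split => //.
under eq_integral do rewrite /= ger0_norm //.
by rewrite ltey.
Qed.

(** * Discretization and truncation of the weights *)

Lemma level_partition {R : realType} {d : measure_display} {T : measurableType d}
    (w : T -> R) (e : R) (P : nat) :
  measurable_fun setT w -> (forall x, 0 <= w x) -> 0 < e ->
  exists idx : T -> 'I_P.+1, (forall k, measurable (idx @^-1` [set k])) /\
    forall x, e * (idx x)%:R <= w x /\ ((idx x < P)%N -> w x <= e * (idx x)%:R + e).
Proof.
move=> mw w0 e0.
pose t x := minn (Num.truncn (w x / e)) P.
have tP x : (t x < P.+1)%N by rewrite ltnS geq_minr.
have t_ge x k : (k <= P)%N -> (k <= t x)%N = (e * k%:R <= w x).
  move=> kP; rewrite /t leq_min kP andbT truncn_ge_nat; last by rewrite divr_ge0 // ltW.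
  by rewrite ler_pdivlMr // mulrC.
exists (fun x => Ordinal (tP x)); split => [k|x]; last first.
  split=> /=; first by rewrite -t_ge ?leqnn // -ltnS.
  move=> tlt; apply/ltW; rewrite -[X in _ + X]mulr1 -mulrDr natr1 ltNge -t_ge //.
  by rewrite ltnn.
have mge r : measurable [set x | r <= w x].
  have := mw measurableT `[r, +oo[%classic (measurable_itv _); rewrite setTI.
  by congr measurable; apply/seteqP; split => x /=; rewrite in_itv /= andbT.
(* The top level [P] collects all larger values, so nothing is removed from it. *)
have -> : (fun x => Ordinal (tP x)) @^-1` [set k] = [set x | e * k%:R <= w x] `\`
    (if (k < P)%N then [set x | e * k.+1%:R <= w x] else set0).
  apply/seteqP; split => x /=.
    move=> /(congr1 val) /= <-; split; first by rewrite /= -t_ge // -ltnS.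
    by case: ifP => [tlt|_ []]; rewrite /= -t_ge // ltnn.
  rewrite -t_ge; last by rewrite -ltnS.
  move=> [kt nk]; apply/val_inj/eqP => /=; rewrite eqn_leq kt andbT.
  move: nk; case: ifPn => [kP /=|]; last by rewrite -leqNgt => Pk _; rewrite geq_min Pk orbT.
  by rewrite -t_ge // => /negP; rewrite -leqNgt.
by apply: measurableD => //; case: ifP.
Qed.

(** Continuity from above: the sets decrease to the empty set because [w] is real-valued, and [mu]
    is finite. *)
Lemma small_tail {R : realType} {d : measure_display} {T : measurableType d}
    (mu : {finite_measure set T -> \bar R}) (w : T -> R) (t : R) :
  measurable_fun setT w -> 0 < t ->
  exists n : nat, (mu [set x | n%:R < w x]%R < t%:E)%E.
Proof.
move=> mw t0.
pose F (n : nat) := [set x | n%:R < w x].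
have mF n : measurable (F n).
  have := mw measurableT `]n%:R, +oo[%classic (measurable_itv _); rewrite setTI.
  by congr measurable; apply/seteqP; split => x /=; rewrite in_itv /= andbT.
have F0 : \bigcap_n F n = set0.
  apply/seteqP; split => // x /(_ (Num.truncn (w x)).+1 I) /=.
  by rewrite /F /= ltNge (ltW (truncnS_gt _)).
have Fmon : {homo F : n m / (n <= m)%N >-> (m <= n)%O}.
  move=> n m nm; apply/subsetPset => x; apply: le_lt_trans.
  by rewrite ler_nat.
have := @nonincreasing_cvg_mu _ _ _ mu F _ mF _ Fmon.
rewrite F0 measure0 -ge0_fin_numE // => /(_ (fin_num_measure _ _ (mF 0%N)) measurable0).
move=> /(_ [set y | (y < t%:E)%E]) [].
  by apply: open_nbhs_nbhs; split; [exact: open_ereal_lt_ereal|rewrite /= lte_fin].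
by move=> n _ /(_ n (leqnn n)) /= h; exists n.
Qed.

(** With [n] from [small_tail], the step function is at most [n] plus [N] on the tail. Thus [K] is
    independent of the partition and of [N], and the mean grows in [N] with slope at most [t], even
    if [w] is not integrable. *)
Lemma truncated_mean_bound {R : realType} {d : measure_display} {T : measurableType d}
    (mu : {finite_measure set T -> \bar R}) (w : T -> R) (t : R) :
  measurable_fun setT w -> (forall x, 0 <= w x) -> 0 < t ->
  exists K, forall (F : finType) (phi : T -> F) (a : F -> R) (N : R),
    (forall i, measurable (phi @^-1` [set i])) ->
    (forall x, a (phi x) <= w x) -> (forall i, a i <= N) -> 0 <= N ->
    \sum_i a i * fine (mu (setT `&` phi @^-1` [set i])) <= K + N * t.
Proof.
move=> mw w0 t0; have [n hn] := small_tail mu w t mw t0.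
have mA : measurable [set x | n%:R < w x].
  have := mw measurableT `]n%:R, +oo[%classic (measurable_itv _); rewrite setTI.
  by congr measurable; apply/seteqP; split => x /=; rewrite in_itv /= andbT.
exists (n%:R * fine (mu setT)) => F phi a N mphi aw aN N0.
rewrite -lee_fin -(integral_step phi mphi mu a setT measurableT).
pose A := [set x | n%:R < w x].
apply: (@le_trans _ _ (\int[mu]_x (n%:R%:E + N%:E * (\1_A x)%:E))%E).
  apply: le_integral => //; first exact: integrable_step.
    apply: integrableD => //; first exact: finite_measure_integrable_cst.
    by apply: integrableZl => //; exact: integrable_indic.
  move=> x _; rewrite -EFinM -EFinD lee_fin indicE.
  have [xA|xA] := leP (w x) n%:R.
    by rewrite memNset ?mulr0 ?addr0 /= ?(le_trans (aw x)) // /A /= ltNge xA.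
  by rewrite mem_set // mulr1 (le_trans (aN _)) // lerDr.
rewrite integralD //; last 2 first.
  exact: finite_measure_integrable_cst.
  by apply: integrableZl => //; exact: integrable_indic.
rewrite integralZl //; last exact: integrable_indic.
rewrite integral_cst // integral_indic // setIT EFinD EFinM.
rewrite fineK ?fin_num_measure // leeD2l // EFinM lee_wpmul2l ?lee_fin //.
exact: ltW.
Qed.

(** * Spreading a finite plan over the cells *)

(** [rho i] is the fraction of cell [i] that is transported. The last clause computes the mass sent
    from a part of the cell of mass [a] when [g i j] is spread proportionally to the product
    measure. *)
Lemma plan_densities {R : realFieldType} {F G : finType} (g : F -> G -> R)
    (m : F -> R) (n : G -> R) :
  (forall i j, 0 <= g i j) ->
  (forall i, \sum_j g i j <= m i) -> (forall j, \sum_i g i j <= n j) ->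
  exists rho : F -> R,
    [/\ forall i, 0 <= rho i <= 1, forall i, rho i * m i = \sum_j g i j,
        forall i, \sum_j g i j = m i -> rho i = 1 &
        forall i a, 0 <= a <= m i ->
          \sum_j g i j / (m i * n j) * (a * n j) = rho i * a].
Proof.
move=> g0 gm gn.
have G0 i : 0 <= \sum_j g i j by exact: sumr_ge0.
have m0 i : 0 <= m i by exact: le_trans (G0 i) (gm i).
(* on null cells the density is irrelevant; the value 1 makes them fully covered *)
exists (fun i => if m i == 0 then 1 else (\sum_j g i j) / m i); split=> i.
- case: eqP => [_|/eqP mi]; first by rewrite ler01 lexx.
  have mi0 : 0 < m i by rewrite lt_def mi m0.
  by rewrite divr_ge0 //= ler_pdivrMr // mul1r.
- case: eqP => [mi|/eqP mi]; last by rewrite divfK.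
  by apply/eqP; rewrite mi mulr0 eq_le G0 /=; have := gm i; rewrite mi.
- by case: eqP => [//|/eqP mi] ->; rewrite divff.
- move=> a /andP[a0 am]; case: eqP => [mi|/eqP mi].
    have -> : a = 0 by apply/eqP; rewrite eq_le a0 -mi am.
    by rewrite mulr0 big1 // => j _; rewrite mul0r mulr0.
  rewrite mulr_suml mulr_suml; apply: eq_bigr => j _.
  have [nj|nj] := eqVneq (n j) 0; last by rewrite invfM -!mulrA; congr (_ * (_ * _)); rewrite mulrCA mulVf ?mulr1.
  have -> : g i j = 0; last by rewrite !mul0r.
  apply/eqP; rewrite eq_le g0 andbT -nj; apply: le_trans (gn j).
  by rewrite (bigD1 i) //= lerDl sumr_ge0.
Qed.

(** Spreading [g i j] proportionally to the product measure of each pair of cells makes both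
    marginal densities constant on cells. *)
Lemma step_plan {R : realType} {d : measure_display} {T : measurableType d}
    {F : finType} (phi : T -> F) (mu nu : {finite_measure set T -> \bar R})
    (g : F -> F -> R) :
  let m i := fine (mu (setT `&` phi @^-1` [set i])) in
  let n j := fine (nu (setT `&` phi @^-1` [set j])) in
  (forall i, measurable (phi @^-1` [set i])) ->
  (forall i j, 0 <= g i j) ->
  (forall i, \sum_j g i j <= m i) -> (forall j, \sum_i g i j <= n j) ->
  exists (gamma : {finite_measure set (T * T)%type -> \bar R}) (rho1 rho2 : F -> R),
    [/\ Pi_le mu nu gamma (rho1 \o phi) (rho2 \o phi),
        forall i j, gamma ((phi @^-1` [set i]) `*` (phi @^-1` [set j])) = (g i j)%:E,
        forall i, [/\ 0 <= rho1 i <= 1, rho1 i * m i = \sum_j g i j &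
                     \sum_j g i j = m i -> rho1 i = 1] &
        forall j, [/\ 0 <= rho2 j <= 1, rho2 j * n j = \sum_i g i j &
                     \sum_i g i j = n j -> rho2 j = 1]].
Proof.
move=> m n mphi g0 gm gn.
have fine_cell (rho : {finite_measure set T -> \bar R}) A i : measurable A ->
    0 <= fine (rho (A `&` phi @^-1` [set i])) <= fine (rho (setT `&` phi @^-1` [set i])).
  move=> mA; have mA' := measurableI _ _ mA (mphi i).
  rewrite fine_ge0 //= fine_le ?fin_num_measure //; first exact: measurableI.
  by apply: le_measure; rewrite ?inE //; [exact: measurableI|exact: setSI].
have m0 i : 0 <= m i by have /andP[] := fine_cell mu setT i measurableT.
have n0 i : 0 <= n i by have /andP[] := fine_cell nu setT i measurableT.
have [rho1 [rho1_01 rho1m rho1_1 dens1]] := plan_densities g m n g0 gm gn.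
have [rho2 [rho2_01 rho2n rho2_1 dens2]] :=
  plan_densities (fun j i => g i j) n m (fun j i => g0 i j) gn gm.
pose h i j := g i j / (m i * n j).
have h0 i j : 0 <= h i j by rewrite divr_ge0 // mulr_ge0.
have [gamma gammaE] := step_coupling phi mphi mu nu h h0.
have marg1 A : measurable A -> gamma (A `*` setT) =
    (\sum_i rho1 i * fine (mu (A `&` phi @^-1` [set i])))%:E.
  move=> mA; rewrite gammaE //; congr EFin; apply: eq_bigr => i _.
  by rewrite -dens1 // fine_cell.
have marg2 A : measurable A -> gamma (setT `*` A) =
    (\sum_j rho2 j * fine (nu (A `&` phi @^-1` [set j])))%:E.
  move=> mA; rewrite gammaE // exchange_big /=; congr EFin; apply: eq_bigr => j _.
  rewrite -dens2 ?fine_cell //; apply: eq_bigr => i _.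
  by rewrite /h [m i * n j]mulrC [X in _ * X]mulrC.
exists gamma, rho1, rho2; split.
- split; first exact: measurable_step.
  split; first exact: measurable_step.
  split; first by move=> x; have /andP[] := rho1_01 (phi x).
  split; first by move=> x; have /andP[] := rho2_01 (phi x).
  split; [|split; [|split]] => A mA.
  + rewrite marg1 // (sum_measure_fibers phi mphi mu A mA) lee_fin.
    apply: ler_sum => i _; have /andP[a0 _] := fine_cell mu A i mA.
    by rewrite ler_piMl //; have /andP[] := rho1_01 i.
  + rewrite marg2 // (sum_measure_fibers phi mphi nu A mA) lee_fin.
    apply: ler_sum => i _; have /andP[a0 _] := fine_cell nu A i mA.
    by rewrite ler_piMl //; have /andP[] := rho2_01 i.
  + by rewrite marg1 // (integral_step phi mphi mu rho1).
  + by rewrite marg2 // (integral_step phi mphi nu rho2).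
- move=> i j; rewrite gammaE //.
  have disj k l (rho : {finite_measure set T -> \bar R}) : l != k ->
      fine (rho (phi @^-1` [set k] `&` phi @^-1` [set l])) = 0.
    move=> lk; rewrite (_ : _ `&` _ = set0) ?measure0 //.
    by apply/seteqP; split => x //= [-> kl]; rewrite kl eqxx in lk.
  have mE : fine (mu (phi @^-1` [set i] `&` phi @^-1` [set i])) = m i.
    by rewrite setIid /m setTI.
  have nE : fine (nu (phi @^-1` [set j] `&` phi @^-1` [set j])) = n j.
    by rewrite setIid /n setTI.
  rewrite (bigD1 i) //= [X in _ + X]big1 ?addr0; last first.
    by move=> k ki; rewrite big1 // => l _; rewrite disj // mul0r mulr0.
  rewrite (bigD1 j) //= [X in _ + X]big1 ?addr0; last first.
    by move=> l lj; rewrite (disj j) // !mulr0.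
  (* On a null pair the quotient [h i j] is zero by convention; the marginal bounds force
     [g i j = 0] as well. *)
  rewrite mE nE /h; have [mn0|mn0] := eqVneq (m i * n j) 0; last by rewrite divfK.
  rewrite mn0 mulr0; congr EFin; apply/eqP; rewrite eq_le g0 /=.
  have gi : g i j <= m i by apply: le_trans (gm i); rewrite (bigD1 j) //= lerDl sumr_ge0.
  have gj : g i j <= n j by apply: le_trans (gn j); rewrite (bigD1 i) //= lerDl sumr_ge0.
  by move/eqP: mn0; rewrite mulf_eq0 => /orP[] /eqP h0'; [rewrite h0' in gi|rewrite h0' in gj].
- by move=> i; split; [exact: rho1_01|exact: rho1m|exact: rho1_1].
- by move=> j; split; [exact: rho2_01|exact: rho2n|exact: rho2_1].
Qed.

(** On a fully transported cell the factor [1 - rho] vanishes, however large [w] is there; elsewhere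
    [w <= a + e]. Either way [a + e] may replace [w]. *)
Lemma uncovered_cost_le {R : realType} {d : measure_display} {T : measurableType d}
    {F : finType} (phi : T -> F) (mu : {finite_measure set T -> \bar R}) (w : T -> R)
    (a rho G : F -> R) (e : R) :
  let m i := fine (mu (setT `&` phi @^-1` [set i])) in
  (forall i, measurable (phi @^-1` [set i])) ->
  measurable_fun setT w -> (forall x, 0 <= w x) -> 0 <= e -> (forall i, 0 <= G i) ->
  (forall i, [/\ 0 <= rho i <= 1, rho i * m i = G i & G i = m i -> rho i = 1]) ->
  (forall x, G (phi x) = m (phi x) \/ w x <= a (phi x) + e) ->
  (\int[mu]_x (w x * (1 - rho (phi x)))%:E <=
   (\sum_i a i * (m i - G i) + e * fine (mu setT))%:E)%E.
Proof.
move=> m mphi mw w0 e0 G0 rhoP wa.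
apply: (@le_trans _ _ (\int[mu]_x ((a (phi x) + e) * (1 - rho (phi x)))%:E)%E).
  apply: ge0_le_integral => //.
  - by move=> x _; rewrite lee_fin mulr_ge0 // subr_ge0; have [/andP[]] := rhoP (phi x).
  - apply/measurable_EFinP; apply: measurable_funM => //.
    by apply: measurable_funB => //; exact: measurable_step.
  - by apply/measurable_EFinP/(measurable_step phi mphi (fun i => (a i + e) * (1 - rho i))).
  - move=> x _; rewrite lee_fin; have [/andP[_ rho_le1] _ rho_sat] := rhoP (phi x).
    have [/rho_sat ->|w_le] := wa x; first by rewrite subrr !mulr0.
    by rewrite ler_wpM2r // subr_ge0.
rewrite (integral_step phi mphi mu (fun i => (a i + e) * (1 - rho i)) setT measurableT).
rewrite lee_fin (sum_measure_fibers phi mphi mu setT measurableT) /=.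
rewrite mulr_sumr -big_split /=; apply: ler_sum => i _.
have [_ rhom _] := rhoP i.
rewrite -mulrA mulrBl mul1r rhom mulrDl lerD2l ler_wpM2l // gerBl; exact: G0.
Qed.

(** * Duality *)

Section duality.
Context {R : realType} {d : measure_display} {T : measurableType d}.
Variables (b lambda : R) (c : T -> T -> R) (w1 w2 : T -> R).
Hypotheses (b0 : 0 <= b) (lambda0 : 0 <= lambda) (c0 : forall x, c x x = 0).
Hypotheses (mw1 : measurable_fun setT w1) (mw2 : measurable_fun setT w2).
Hypotheses (w10 : forall x, 0 <= w1 x) (w20 : forall x, 0 <= w2 x).
(* Compactness of the tree and continuity of the cost enter only through this. *)
Hypothesis c_partition : forall e, 0 < e -> exists (F : finType) (phi : T -> F),
  (forall i, measurable (phi @^-1` [set i])) /\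
  forall x y x' y', phi x = phi x' -> phi y = phi y' -> c x' y' <= c x y + e.
Variables mu nu : {finite_measure set T -> \bar R}.

Local Notation D := (ET_dual b lambda c w1 w2 mu nu).

Lemma measurable_cost : measurable_fun setT (fun z : T * T => c z.1 z.2).
Proof.
apply: measurable_fun_small_oscillation => e /c_partition[F [phi [mphi osc]]].
exists (F * F)%type, (fun z => (phi z.1, phi z.2)); split => [[i j]|x y [h1 h2]].
  have -> : (fun z : T * T => (phi z.1, phi z.2)) @^-1` [set (i, j)] =
      (phi @^-1` [set i]) `*` (phi @^-1` [set j]).
    by apply/seteqP; split => z /=; [case=> -> ->|case=> -> ->].
  exact: measurableX.
exact: osc.
Qed.

(** On each pair of cells of tolerance 1 the cost stays within 1 of one of its values; the sum of
    these finitely many bounds serves globally. *)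
Lemma bounded_cost : exists2 M, 0 <= M & forall x y, `|c x y| <= M.
Proof.
have [F [phi [mphi osc]]] := c_partition 1 ltr01.
have H (p : F * F) : exists m, 0 <= m /\
    forall x y, phi x = p.1 -> phi y = p.2 -> `|c x y| <= m.
  have [[[x0 y0] /= [hx hy]]|nex] := pselect (exists z : T * T, phi z.1 = p.1 /\ phi z.2 = p.2).
    exists (`|c x0 y0| + 1); split; first by rewrite addr_ge0.
    move=> x y hx' hy'.
    have h1 : c x y <= c x0 y0 + 1 by apply: osc; congruence.
    have h2 : c x0 y0 <= c x y + 1 by apply: osc; congruence.
    have := ler_norm (c x0 y0); have := ler_norm (- c x0 y0); rewrite normrN ler_norml.
    by move=> ? ?; apply/andP; split; lra.
  by exists 0; split => // x y hx hy; exfalso; apply: nex; exists (x, y).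
have [m hm] := choice H.
exists (\sum_p m p) => [|x y]; first by apply: sumr_ge0 => p _; exact: (hm p).1.
apply: le_trans ((hm (phi x, phi y)).2 x y erefl erefl) _.
by rewrite (bigD1 (phi x, phi y)) //= lerDl sumr_ge0 // => p _; exact: (hm p).1.
Qed.

Lemma integrable_cost (gamma : {finite_measure set (T * T)%type -> \bar R}) :
  gamma.-integrable setT (fun z => (c z.1 z.2 - lambda)%:E).
Proof.
have [M M0 cM] := bounded_cost.
apply: (@measurable_bounded_integrable _ _ _ gamma (fun z => c z.1 z.2 - lambda)) => //.
- by rewrite -ge0_fin_numE // fin_num_measure.
- by apply: measurable_funB => //; exact: measurable_cost.
- exists (M + `|lambda|); split; first by rewrite num_real.
  move=> K hK x _ /=; apply: le_trans (ltW hK).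
  by apply: le_trans (ler_normB _ _) _; rewrite lerD2r cM.
Qed.

(** Apply [marginal_duality] to both projections, then integrate the constraint on [u x + v y]
    against [gamma]. *)
Lemma weak_duality : (D <= ET b lambda c w1 w2 mu nu)%E.
Proof.
apply: ge_ereal_sup => _ /= [[u v] /= [intu intv uw1 vw uv] <-].
apply: le_ereal_inf_tmp => _ [gamma [f1 [f2 [+ ->]]]].
move=> [mf1 [mf2 [f10 [f20 [le1 [le2 [dens1 dens2]]]]]]].
have fstE A : fst @^-1` A = A `*` setT :> set (T * T).
  by apply/seteqP; split => z //= -[].
have sndE A : snd @^-1` A = setT `*` A :> set (T * T).
  by apply/seteqP; split => z //= -[].
have [||iu W1 h1] := @marginal_duality _ _ _ _ _ (@fst T T) mu gamma f1 u w1
    measurable_fst mf1 mw1 f10 w10 uw1 _ _ intu.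
- by move=> A mA; rewrite fstE le1.
- by move=> A mA; rewrite fstE dens1.
have [|||iv W2 h2] := @marginal_duality _ _ _ _ _ (@snd T T) nu gamma f2 v w2
    measurable_snd mf2 mw2 f20 w20 _ _ _ intv.
- by move=> y; have [] := vw y.
- by move=> A mA; rewrite sndE le2.
- by move=> A mA; rewrite sndE dens2.
apply: le_trans (leeD h1 h2) _.
rewrite addeACA addeC /ET_cost leeD2l //.
rewrite -(integralD_EFin measurableT iu iv) -integralZl //; last exact: integrable_cost.
apply: le_integral => //.
- exact: integrableD.
- by apply: integrableZl => //; exact: integrable_cost.
- by move=> z _ /=; rewrite -EFinM lee_fin uv.
Qed.

(* The lower bound on [v] in [Kset] costs nothing: [v] may be replaced by its
   maximum with that lower bound. *)
Lemma ge_ET_dual (u v : T -> R) :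
  mu.-integrable setT (EFin \o u) -> nu.-integrable setT (EFin \o v) ->
  (forall x, u x <= w1 x) -> (forall y, v y <= w2 y) ->
  (forall x y, u x + v y <= b * (c x y - lambda)) ->
  (\int[mu]_x (u x)%:E + \int[nu]_y (v y)%:E <= D)%E.
Proof.
move=> intu intv uw1 vw2 uv.
have [M M0 cM] := bounded_cost.
have bc x y : - (b * M) <= b * c x y <= b * M.
  by rewrite -mulrN !ler_wpM2l //; have := cM x y; rewrite ler_norml => /andP[].
have bl0 : 0 <= b * lambda by rewrite mulr_ge0.
pose I y := ereal_inf [set (b * c x y - w1 x)%:E | x in setT].
have I_le x y : (I y <= (b * c x y - w1 x)%:E)%E.
  by apply: ereal_inf_lbound; exists x.
have I_ge y z : (forall x, z <= (b * c x y - w1 x)%:E)%E -> (z <= I y)%E.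
  by move=> h; apply: le_ereal_inf_tmp => _ [x _ <-].
(* If [w1] is unbounded, the infimum is below every real because the cost is bounded, so any [v]
   meets the lower bound. *)
have [[B w1B]|unb] := pselect (exists B, forall x, w1 x <= B); last first.
  apply: ereal_sup_ubound; exists (u, v) => //=; split => // y; split => //.
  have [x hx] : exists x, b * M - v y - b * lambda < w1 x.
    apply: contrapT => h; apply: unb; exists (b * M - v y - b * lambda) => x.
    by rewrite leNgt; apply/negP => hx; apply: h; exists x.
  have : (I y <= (v y + b * lambda)%:E)%E.
    apply: le_trans (I_le x y) _; rewrite lee_fin; have /andP[_] := bc x y; lra.
  move=> /(leeD2l (- (b * lambda))%:E) /le_trans; apply.
  by rewrite -EFinD lee_fin /=; lra.
have I_fin y : I y \is a fin_num.
  rewrite fin_numE; apply/andP; split.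
    rewrite gt_eqF // (@lt_le_trans _ _ (- (b * M) - B)%:E) ?ltNyr //.
    apply: I_ge => x; rewrite lee_fin; have /andP[+ _] := bc x y; have := w1B x; lra.
  by rewrite lt_eqF // (le_lt_trans (I_le y y)) // ltry.
pose L y := - (b * lambda) + fine (I y).
have LE y : ((- (b * lambda))%:E + I y = (L y)%:E)%E by rewrite EFinD fineK.
have L_le x y : L y <= b * (c x y - lambda) - w1 x.
  by have := I_le x y; rewrite -(fineK (I_fin y)) lee_fin /L; lra.
have L_le0 y : L y <= 0.
  by have := L_le y y; rewrite c0; have := w10 y; lra.
have L_ge y z : (forall x, z <= b * (c x y - lambda) - w1 x) -> z <= L y.
  move=> h; have : ((z + b * lambda)%:E <= I y)%E.
    by apply: I_ge => x; rewrite lee_fin; have := h x; lra.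
  by rewrite -(fineK (I_fin y)) lee_fin /L; lra.
have mL : measurable_fun setT L.
  apply: measurable_fun_small_oscillation => e e0.
  have b1 : 0 < b + 1 by have := b0; lra.
  (* Dividing by [b + 1] rather than [b] covers [b = 0]. *)
  have e'0 : 0 < e / (b + 1) by rewrite divr_gt0.
  have [F [phi [mphi osc]]] := c_partition _ e'0.
  exists F, phi; split => // x y xy.
  rewrite -lerBlDr; apply: L_ge => z; have := L_le z y.
  have : b * c z y <= b * c z x + e.
    apply: (@le_trans _ _ (b * (c z x + e / (b + 1)))).
      by rewrite ler_wpM2l //; exact: osc.
    rewrite mulrDr lerD2l mulrCA ler_piMr ?(ltW e0) // ler_pdivrMr ?mul1r ?lerDl //; lra.
  lra.
have mv : measurable_fun setT v by exact/measurable_EFinP/(measurable_int _ intv).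
pose v' y := Num.max (v y) (L y).
have intv' : nu.-integrable setT (EFin \o v').
  pose K := b * M + b * lambda + `|B|.
  apply: (@le_integrable _ _ _ nu setT measurableT _ (EFin \o (fun y => `|v y| + K))).
  - by apply/measurable_EFinP; exact: measurable_maxr.
  - move=> y _ /=; rewrite lee_fin.
    have LK : - K <= L y.
      apply: L_ge => x; have := bc x y; have := w1B x; have := ler_norm B.
      by rewrite /K => h1 h2 /andP[h3 h4]; lra.
    have K0 : 0 <= K by rewrite /K !addr_ge0 // mulr_ge0.
    have -> : `| `|v y| + K| = `|v y| + K by rewrite ger0_norm // addr_ge0.
    have : - (`|v y| + K) <= v' y <= `|v y| + K; last by rewrite ler_norml.
    rewrite /v'.
    have := ler_norm (v y); have := ler_norm (- v y); rewrite normrN.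
    have := L_le0 y; rewrite /Num.max; case: ifP => _ ? ? ?; apply/andP; split; lra.
  - apply: (@integrableD _ _ _ nu setT measurableT (fun y => `|v y|%:E) (cst K%:E)).
      exact: (integrable_abse intv).
    exact: finite_measure_integrable_cst.
apply: (@le_trans _ _ (\int[mu]_x (u x)%:E + \int[nu]_y (v' y)%:E)%E).
  rewrite leeD2l //; apply: le_integral => // y _.
  by rewrite lee_fin /v' le_max lexx.
apply: ereal_sup_ubound; exists (u, v') => //=; split => //.
- move=> y; split; first by rewrite LE lee_fin /v' le_max lexx orbT.
  by rewrite /v' ge_max vw2 (le_trans (L_le0 y)).
- move=> x y; rewrite /v' addr_maxr ge_max uv /=.
  by have := L_le x y; have := uw1 x; lra.
Qed.

(** * Strong duality when one measure vanishes *)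

Lemma ET_le_trivial_plan :
  (ET b lambda c w1 w2 mu nu <= \int[mu]_x (w1 x)%:E + \int[nu]_y (w2 y)%:E)%E.
Proof.
apply: ereal_inf_lbound; exists mzero, (fun=> 0), (fun=> 0); split.
  split => //; split => //; split => //; split => //.
  split; [|split; [|split]] => A mA; [exact: measure_ge0|exact: measure_ge0|..];
    by rewrite integral0_eq.
rewrite /ET_cost integral_measure_zero mule0 adde0.
by congr (_ + _)%E; apply: eq_integral => x _; rewrite subr0 mulr1.
Qed.

(** Monotone convergence; potentials must be integrable while the weights need not be, so only
    truncated weights can be tested in the dual. *)
Lemma integral_le_truncations (rho : {finite_measure set T -> \bar R}) (w : T -> R)
    (z : \bar R) :
  measurable_fun setT w -> (forall x, 0 <= w x) ->
  (forall n : nat, \int[rho]_x (Num.min (w x) n%:R)%:E <= z)%E ->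
  (\int[rho]_x (w x)%:E <= z)%E.
Proof.
move=> mw w0 hz.
pose g (n : nat) x := (Num.min (w x) n%:R)%:E.
have mg n : measurable_fun setT (g n).
  by apply/measurable_EFinP; exact: measurable_minr.
have g0 n x : setT x -> (0 <= g n x)%E by rewrite lee_fin le_min w0 ler0n.
have gmon x : setT x -> {homo g ^~ x : n m / (n <= m)%N >-> (n <= m)%E}.
  by move=> _ n m nm; rewrite lee_fin le_min !ge_min lexx ler_nat nm orbT.
have glim x : limn (g ^~ x) = (w x)%:E.
  apply: lim_near_cst => //; exists (Num.truncn (w x)).+1 => // n /= hn.
  rewrite /g min_l //; apply/ltW/(lt_le_trans (truncnS_gt _)).
  by rewrite ler_nat.
have -> : (\int[rho]_x (w x)%:E = \int[rho]_x limn (g ^~ x))%E.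
  by apply: eq_integral => x _; rewrite glim.
rewrite monotone_convergence //; apply: lime_le; last exact: nearW.
apply: ereal_nondecreasing_is_cvgn => n m nm.
apply: ge0_le_integral => // x xT; [exact: g0|exact: gmon].
Qed.

Lemma strong_duality_null_target : nu setT = 0%E ->
  (ET b lambda c w1 w2 mu nu <= D)%E.
Proof.
move=> nu0; apply: le_trans ET_le_trivial_plan _.
have int0 f : measurable_fun setT f -> (\int[nu]_y (f y)%:E = 0)%E.
  by move=> mf; apply: null_set_integral => //; exact/measurable_EFinP.
rewrite int0 // adde0; apply: integral_le_truncations => // n.
have [M M0 cM] := bounded_cost.
(* As [nu] is null, [v] can be a very negative constant at no cost; this one makes room for any
   [u <= n]. *)
pose K := - (n%:R + b * (M + lambda)).
have bM0 : 0 <= b * (M + lambda) by rewrite mulr_ge0 // addr_ge0.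
have := @ge_ET_dual (fun x => Num.min (w1 x) n%:R) (fun=> K).
rewrite int0 // adde0; apply.
- apply: measurable_bounded_integrable => //.
  + by rewrite -ge0_fin_numE // fin_num_measure.
  + exact: measurable_minr.
  + exists n%:R; split; first by rewrite num_real.
    move=> A hA x _ /=; apply: le_trans (ltW hA).
    by rewrite ger0_norm ?le_min ?w10 ?ler0n // ge_min lexx orbT.
- exact: finite_measure_integrable_cst.
- by move=> x; rewrite ge_min lexx.
- by move=> y; apply: le_trans (w20 y); rewrite oppr_le0 addr_ge0.
- move=> x y; rewrite /K.
  have : Num.min (w1 x) n%:R <= n%:R by rewrite ge_min lexx orbT.
  have : b * - (M + lambda) <= b * (c x y - lambda).
    by rewrite ler_wpM2l //; have := cM x y; rewrite ler_norml => /andP[h1 h2]; lra.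
  by rewrite mulrN; lra.
Qed.

Lemma strong_duality_null_source : mu setT = 0%E ->
  (ET b lambda c w1 w2 mu nu <= D)%E.
Proof.
move=> mu0; apply: le_trans ET_le_trivial_plan _.
have int0 f : measurable_fun setT f -> (\int[mu]_y (f y)%:E = 0)%E.
  by move=> mf; apply: null_set_integral => //; exact/measurable_EFinP.
rewrite int0 // add0e; apply: integral_le_truncations => // n.
have [M M0 cM] := bounded_cost.
(* The same choice with the roles of the potentials exchanged. *)
pose K := - (n%:R + b * (M + lambda)).
have bM0 : 0 <= b * (M + lambda) by rewrite mulr_ge0 // addr_ge0.
have := @ge_ET_dual (fun=> K) (fun y => Num.min (w2 y) n%:R).
rewrite int0 // add0e; apply.
- exact: finite_measure_integrable_cst.
- apply: measurable_bounded_integrable => //.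
  + by rewrite -ge0_fin_numE // fin_num_measure.
  + exact: measurable_minr.
  + exists n%:R; split; first by rewrite num_real.
    move=> A hA x _ /=; apply: le_trans (ltW hA).
    by rewrite ger0_norm ?le_min ?w20 ?ler0n // ge_min lexx orbT.
- by move=> x; apply: le_trans (w10 x); rewrite oppr_le0 addr_ge0.
- by move=> y; rewrite ge_min lexx.
- move=> x y; rewrite /K.
  have : Num.min (w2 y) n%:R <= n%:R by rewrite ge_min lexx orbT.
  have : b * - (M + lambda) <= b * (c x y - lambda).
    by rewrite ler_wpM2l //; have := cM x y; rewrite ler_norml => /andP[h1 h2]; lra.
  by rewrite mulrN; lra.
Qed.

(** * Strong duality by discretization *)

(** Both sides are compared with the finite dual value: the spread plan bounds [ET] from above, and
    the step potentials, slightly lowered, bound the dual from below. The two errors add up to the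
    stated one. *)
Lemma strong_duality_step (F : finType) (phi : T -> F) (a1 a2 : F -> R) (e M N : R) :
  let m0 := fine (mu setT) in let n0 := fine (nu setT) in
  let m i := fine (mu (setT `&` phi @^-1` [set i])) in
  let n i := fine (nu (setT `&` phi @^-1` [set i])) in
  (forall i, measurable (phi @^-1` [set i])) ->
  (forall x y x' y', phi x = phi x' -> phi y = phi y' -> c x' y' <= c x y + e) ->
  0 < e -> 0 <= M -> (forall x y, `|b * (c x y - lambda)| <= M) ->
  (forall i, 0 <= a1 i) -> (forall i, 0 <= a2 i) ->
  (forall x, a1 (phi x) <= w1 x /\ (a1 (phi x) = N \/ w1 x <= a1 (phi x) + e)) ->
  (forall x, a2 (phi x) <= w2 x /\ (a2 (phi x) = N \/ w2 x <= a2 (phi x) + e)) ->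
  e * m0 <= 1 ->
  \sum_i a1 i * m i < (N - 2 * M - 1) * n0 ->
  \sum_i a2 i * n i < (N - 2 * M - 1) * m0 ->
  T ->
  (ET b lambda c w1 w2 mu nu <=
   D + (e * (m0 + n0 + b * m0 + b * n0 + m0 * n0))%:E)%E.
Proof.
move=> m0 n0 m n mphi osc e0 M0 CM a10 a20 aw1 aw2 em0 sat1 sat2 t0.
have sum_m : \sum_i m i = m0.
  by rewrite /m0 (sum_measure_fibers phi mphi mu setT measurableT).
have sum_n : \sum_i n i = n0.
  by rewrite /n0 (sum_measure_fibers phi mphi nu setT measurableT).
have m_ge0 i : 0 <= m i by exact: fine_ge0.
have n_ge0 i : 0 <= n i by exact: fine_ge0.
(* [r] picks a representative of each cell; an empty cell receives [t0]. *)
have [r rP] : exists r : F -> T, forall x, phi (r (phi x)) = phi x.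
  have H i : exists t, forall x, phi x = i -> phi t = i.
    have [[t ti]|nt] := pselect (exists t, phi t = i); first by exists t.
    by exists t0 => x xi; exfalso; apply: nt; exists x.
  by have [r hr] := choice H; exists r => x; exact: (hr (phi x) x erefl).
pose C i j := b * (c (r i) (r j) - lambda).
rewrite -sum_n in sat1; rewrite -sum_m in sat2 em0.
(* The tolerance [e] also serves as the penalty parameter [eta]. *)
have [u [v [g [[ua1 va2 uvC] [g0 gm gn val]]]]] := finite_partial_duality m n C e M N a1 a2
  e0 M0 em0 m_ge0 n_ge0 a10 a20 (fun i j => CM (r i) (r j)) sat1 sat2.
have [gamma [rho1 [rho2 [Pi gammaE rho1P rho2P]]]] := step_plan phi mu nu g mphi g0
  (fun i => (gm i).1) (fun j => (gn j).1).
have sum_g : \sum_i \sum_j g i j <= m0.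
  by rewrite -sum_m; apply: ler_sum => i _; exact: (gm i).1.
have mcost : (\int[mu]_x (w1 x * (1 - rho1 (phi x)))%:E <=
    (\sum_i a1 i * (m i - \sum_j g i j) + e * m0)%:E)%E.
  apply: uncovered_cost_le => //; first exact: ltW.
    by move=> i; exact: sumr_ge0.
  (* Cells at level [N] are fully transported; on the others [a1] approximates [w1] within [e]. *)
  by move=> x; have [_ [/(gm (phi x)).2|]] := aw1 x; [left|right].
have ncost : (\int[nu]_x (w2 x * (1 - rho2 (phi x)))%:E <=
    (\sum_j a2 j * (n j - \sum_i g i j) + e * n0)%:E)%E.
  apply: (@uncovered_cost_le _ _ _ _ phi nu w2 a2 rho2 (fun j => \sum_i g i j)) => //; first exact: ltW.
    by move=> j; exact: sumr_ge0.
  by move=> x; have [_ [/(gn (phi x)).2|]] := aw2 x; [left|right].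
have ccost : (b%:E * \int[gamma]_z (c z.1 z.2 - lambda)%:E <=
    (\sum_i \sum_j C i j * g i j + e * b * m0)%:E)%E.
  pose phi2 (z : T * T) := (phi z.1, phi z.2).
  have phi2E i j : phi2 @^-1` [set (i, j)] = (phi @^-1` [set i]) `*` (phi @^-1` [set j]).
    by apply/seteqP; split => z /=; [case=> -> ->|case=> /= h1 h2; rewrite /phi2 h1 h2].
  have mphi2 p : measurable (phi2 @^-1` [set p]).
    by case: p => i j; rewrite phi2E; exact: measurableX.
  pose s (p : F * F) := c (r p.1) (r p.2) - lambda + e.
  apply: (@le_trans _ _ (b%:E * \int[gamma]_z (s (phi2 z))%:E)%E).
    rewrite lee_wpmul2l ?lee_fin //; apply: le_integral => //.
    - exact: integrable_cost.
    - exact: (integrable_step phi2 mphi2 gamma s).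
    - by move=> z _; rewrite lee_fin /s /= addrAC lerD2r; apply: osc; rewrite rP.
  rewrite (integral_step phi2 mphi2 gamma s setT measurableT) -EFinM lee_fin.
  have -> : \sum_p s p * fine (gamma (setT `&` phi2 @^-1` [set p])) =
      \sum_i \sum_j s (i, j) * g i j.
    rewrite pair_big /=; apply: eq_bigr => -[i j] _ /=.
    by rewrite setTI phi2E gammaE.
  rewrite mulr_sumr.
  apply: (@le_trans _ _ (\sum_i \sum_j C i j * g i j + e * b * \sum_i \sum_j g i j)).
    rewrite [X in _ <= _ + X]mulr_sumr -big_split /=; apply: ler_sum => i _.
    rewrite !mulr_sumr -big_split /=; apply: ler_sum => j _.
    by rewrite /s /C /=; lra.
  by rewrite lerD2l ler_wpM2l // mulr_ge0 // ltW.
have primal : (ET b lambda c w1 w2 mu nu <=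
    (\sum_i u i * m i + \sum_j v j * n j + e * (m0 + n0 + b * m0))%:E)%E.
  apply: (@le_trans _ _ (ET_cost b lambda c w1 w2 mu nu gamma (rho1 \o phi) (rho2 \o phi))).
    by apply: ereal_inf_lbound; exists gamma, (rho1 \o phi), (rho2 \o phi).
  apply: le_trans (leeD (leeD mcost ncost) ccost) _.
  by rewrite -!EFinD lee_fin; lra.
(* Lowering [v] by [k] absorbs the penalty violation [e * m0] and the oscillation [b * e] of the
   cost. *)
pose k := e * (b + m0).
have dual : ((\sum_i u i * m i + \sum_j v j * n j - k * n0)%:E <= D)%E.
  have := @ge_ET_dual (u \o phi) ((fun j => v j - k) \o phi).
  rewrite (integral_step phi mphi mu u setT measurableT).
  rewrite (integral_step phi mphi nu (fun j => v j - k) setT measurableT).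
  have -> : \sum_i (v i - k) * fine (nu (setT `&` phi @^-1` [set i])) =
      \sum_j v j * n j - k * n0.
    rewrite -sum_n mulr_sumr -sumrB; apply: eq_bigr => j _; exact: mulrBl.
  rewrite -EFinD addrA; apply.
  - exact: integrable_step.
  - exact: (integrable_step phi mphi nu (fun j => v j - k)).
  - by move=> x; apply: le_trans (ua1 _) (aw1 x).1.
  - move=> y; apply: (@le_trans _ _ (v (phi y))); last exact: le_trans (va2 _) (aw2 y).1.
    by rewrite /= gerBl /k mulr_ge0 ?addr_ge0 ?fine_ge0 // ltW.
  - move=> x y; have := uvC (phi x) (phi y); rewrite sum_m /C /k /=.
    have : b * c (r (phi x)) (r (phi y)) <= b * (c x y + e).
      by rewrite ler_wpM2l //; apply: osc; rewrite rP.
    lra.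
apply: le_trans primal _.
apply: le_trans (leeD2r _ dual); rewrite -EFinD lee_fin /k; lra.
Qed.

Lemma strong_duality : (ET b lambda c w1 w2 mu nu <= D)%E.
Proof.
pose m0 := fine (mu setT); pose n0 := fine (nu setT).
have muE : mu setT = m0%:E by rewrite fineK // fin_num_measure.
have nuE : nu setT = n0%:E by rewrite fineK // fin_num_measure.
have [m00|m0_neq0] := eqVneq m0 0; first by apply: strong_duality_null_source; rewrite muE m00.
have [n00|n0_neq0] := eqVneq n0 0; first by apply: strong_duality_null_target; rewrite nuE n00.
have m0_gt0 : 0 < m0 by rewrite lt_def m0_neq0 fine_ge0.
have n0_gt0 : 0 < n0 by rewrite lt_def n0_neq0 fine_ge0.
have [t0 _] : exists t : T, True.
  apply: contrapT => noT; move/eqP: m0_neq0; apply.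
  rewrite /m0 (_ : setT = set0) ?measure0 //.
  by apply/seteqP; split => // t _; apply: noT; exists t.
apply/lee_addgt0Pr => e e0.
pose S := m0 + n0 + b * m0 + b * n0 + m0 * n0.
have S0 : 0 <= S by rewrite /S !addr_ge0 ?mulr_ge0 // ltW.
(* The first bound keeps the total error below [e]; the second gives [eps * m0 <= 1], required of
   the penalty parameter. *)
pose eps := Num.min (e / (S + 1)) (m0 + 1)^-1.
have eps0 : 0 < eps by rewrite lt_min divr_gt0 ?invr_gt0 //=; lra.
have epsS : eps * S <= e.
  apply: (@le_trans _ _ (e / (S + 1) * S)); first by rewrite ler_wpM2r // ge_min lexx.
  by rewrite mulrAC -mulrA ler_piMr ?(ltW e0) // ler_pdivrMr; lra.
have epsm : eps * m0 <= 1.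
  apply: (@le_trans _ _ ((m0 + 1)^-1 * m0)).
    by rewrite ler_wpM2r ?(ltW m0_gt0) // ge_min lexx orbT.
  by rewrite mulrC ler_pdivrMr; lra.
have [M' M'0 cM'] := bounded_cost.
pose M := b * (M' + `|lambda|).
have M0 : 0 <= M by rewrite mulr_ge0 // addr_ge0.
have CM x y : `|b * (c x y - lambda)| <= M.
  rewrite normrM ger0_norm // ler_wpM2l //.
  by apply: le_trans (ler_normB _ _) _; rewrite lerD2r.
have n20 : 0 < n0 / 2 by lra.
have m20 : 0 < m0 / 2 by lra.
have [K1 hK1] := truncated_mean_bound mu w1 (n0 / 2) mw1 w10 n20.
have [K2 hK2] := truncated_mean_bound nu w2 (m0 / 2) mw2 w20 m20.
(* With slope [n0 / 2], the saturation condition [K1 + N * (n0 / 2) < (N - 2 * M - 1) * n0] amounts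
   to [B1 < N]; likewise for [B2]. *)
pose B1 := 2 * (K1 + (2 * M + 1) * n0) / n0.
pose B2 := 2 * (K2 + (2 * M + 1) * m0) / m0.
pose P := (Num.truncn ((`|B1| + `|B2|) / eps)).+1.
(* A multiple of the level height, so that the truncation level is exactly the top level of the
   weight partitions. *)
pose N := eps * P%:R.
have NB : `|B1| + `|B2| < N.
  by rewrite /N mulrC -ltr_pdivrMr //; exact: truncnS_gt.
have NB1 : B1 < N by have := ler_norm B1; have := normr_ge0 B2; lra.
have NB2 : B2 < N by have := ler_norm B2; have := normr_ge0 B1; lra.
have N0 : 0 <= N by rewrite mulr_ge0 // ltW.
have [F [phi0 [mphi0 osc]]] := c_partition _ eps0.
have [idx1 [midx1 idx1P]] := level_partition w1 eps P mw1 w10 eps0.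
have [idx2 [midx2 idx2P]] := level_partition w2 eps P mw2 w20 eps0.
pose phi x : F * 'I_P.+1 * 'I_P.+1 := (phi0 x, idx1 x, idx2 x).
have mphi i : measurable (phi @^-1` [set i]).
  case: i => -[i k] l.
  have -> : phi @^-1` [set (i, k, l)] =
      phi0 @^-1` [set i] `&` idx1 @^-1` [set k] `&` idx2 @^-1` [set l].
    by apply/seteqP; split => x /=; [case=> -> -> ->|case=> -[h1 h2] h3; rewrite /phi h1 h2 h3].
  by apply: measurableI => //; exact: measurableI.
pose a1 (i : F * 'I_P.+1 * 'I_P.+1) := eps * i.1.2%:R.
pose a2 (i : F * 'I_P.+1 * 'I_P.+1) := eps * i.2%:R.
have level (k : 'I_P.+1) : eps * k%:R <= N.
  by rewrite /N ler_pM2l // ler_nat -ltnS.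
have top (k : 'I_P.+1) y : ((k < P)%N -> y <= eps * k%:R + eps) ->
    eps * k%:R = N \/ y <= eps * k%:R + eps.
  move=> h; have [/h|Pk] := ltnP k P; [by right|left].
  by rewrite /N; congr (_ * _%:R); apply/eqP; rewrite eqn_leq Pk andbT -ltnS.
have step := @strong_duality_step _ phi a1 a2 eps M N mphi _ eps0 M0 CM _ _ _ _ epsm _ _ t0.
apply: le_trans (step _ _ _ _ _ _ _) _; last by rewrite leeD2l // lee_fin.
- by move=> x y x' y' [xx' _ _] [yy' _ _]; exact: osc.
- by move=> i; rewrite mulr_ge0 // ltW.
- by move=> i; rewrite mulr_ge0 // ltW.
- by move=> x; have [h1 h2] := idx1P x; split => //; exact: top.
- by move=> x; have [h1 h2] := idx2P x; split => //; exact: top.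
- apply: le_lt_trans (hK1 _ phi a1 N mphi (fun x => (idx1P x).1) (fun i => level _) N0) _.
  by move: NB1; rewrite /B1 ltr_pdivrMr // -/n0; lra.
- apply: le_lt_trans (hK2 _ phi a2 N mphi (fun x => (idx2P x).1) (fun i => level _) N0) _.
  by move: NB2; rewrite /B2 ltr_pdivrMr // -/m0; lra.
Qed.

End duality.

Theorem theorem3p4 (R : realType) (d : measure_display) (T : measurableType d)
  (dist : T -> T -> R)
  (Htree : finite_metric_tree dist) (Hborel : borel_wrt dist)
  (b : R) (hb : 0 <= b)
  (c : T -> T -> R) (hc : continuous2_wrt dist c) (hc0 : forall x, c x x = 0)
  (w1 w2 : T -> R)
  (hw1m : measurable_fun setT w1) (hw2m : measurable_fun setT w2)
  (hw1 : forall x, 0 <= w1 x) (hw2 : forall x, 0 <= w2 x)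
  (lambda : R) (hlambda : 0 <= lambda)
  (mu nu : {finite_measure set T -> \bar R}) :
  ET b lambda c w1 w2 mu nu = ET_dual b lambda c w1 w2 mu nu.
Proof.
have c_partition e : 0 < e -> exists (F : finType) (phi : T -> F),
    (forall i, measurable (phi @^-1` [set i])) /\
    forall x y x' y', phi x = phi x' -> phi y = phi y' -> c x' y' <= c x y + e.
  move=> e0.
  have [delta delta0 cdelta] := finite_metric_tree_uniformly_continuous dist c Htree hc e e0.
  have [F [phi [mphi phi_delta]]] := finite_metric_tree_partition dist Htree Hborel delta delta0.
  exists F, phi; split => // x y x' y' xx' yy'.
  have := cdelta x y x' y' (phi_delta _ _ xx') (phi_delta _ _ yy').
  by have := ler_norm (c x' y' - c x y); lra.
apply/eqP; rewrite eq_le; apply/andP; split.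
  exact: strong_duality.
exact: weak_duality.
Qed.
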